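(* Consider the regression model $Y_n=f(X_n-\theta)+\varepsilon_n$, $n\ge0$, where $(X_n)$ and $(\varepsilon_n)$ are two independent sequences of independent and identically distributed random variables, $(\varepsilon_n)$ has zero mean and finite positive variance $\sigma^2$, and: (i) the $X_n$ have an unknown probability density function $g$, positive on its support $[-1/2,1/2]$, continuous, twice differentiable with bounded derivatives; (ii) the function $f$ is symmetric (even), bounded and periodic with period $1$. Let $f_1=\int_{-1/2}^{1/2}\cos(2\pi x)f(x)\,dx$ (assumed nonzero), let $C=[-1/4,1/4]$ and let $\pi_C$ be the projection onto $C$ ($\pi_C(x)=x$ if $|x|\le1/4$, $=1/4$ if $x\ge1/4$, $=-1/4$ if $x\le-1/4$). Let $K$ be a symmetric, positive, Lipschitz kernel with compact support, $\int K=1$, $\int K^2<\infty$, $\int x^2K(x)\,dx<\infty$, let $0<\alpha<1$, $h_n=n^{-\alpha}$, and $\widehat g_n(x)=\frac1n\sum_{i=1}^n h_i^{-1}K((X_i-x)/h_i)$. Let $\gamma_n=1/n$ and define, from an initial value $\widehat\theta_1\in C$, for $n\ge1$, $$\widehat\theta_{n+1}=\pi_C\Bigl(\widehat\theta_n+\mathrm{sign}(f_1)\gamma_{n+1}\widehat T_{n+1}\Bigr),\qquad \widehat T_{n+1}=\frac{\sin(2\pi(X_{n+1}-\widehat\theta_n))}{\widehat g_n(X_{n+1})}Y_{n+1}.$$ Assume $|\theta|<1/4$. Then $\widehat\theta_n$ converges almost surely to $\theta$. In addition, the number of indices $n$ for which $\widehat\theta_n+\mathrm{sign}(f_1)\gamma_{n+1}\widehat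 T_{n+1}\notin C$ is almost surely finite. *)

(* Defs.v *)
From HB Require Import structures.
From mathcomp Require Import all_boot all_order all_algebra.
From mathcomp Require Import all_classical all_reals all_analysis.
Set Implicit Arguments. Unset Strict Implicit. Unset Printing Implicit Defensive.
Import Order.TTheory GRing.Theory Num.Theory.
Import numFieldNormedType.Exports.
Local Open Scope classical_set_scope.
Local Open Scope ring_scope.

Definition mutually_independent d (T : measurableType d) (R : realType)
  (P : probability T R) (I : eqType) (Z : I -> T -> R) : Prop :=
  forall (s : seq I) (B : I -> set R), uniq s ->
    (forall i, i \in s -> measurable (B i)) ->
    P (\bigcap_(i in [set` s]) (Z i @^-1` B i)) =
    (\prod_(i <- s) P (Z i @^-1` B i))%E.

Definition projC (R : realType) (x : R) : R :=
  if 1/4 <= x then 1/4 else if x <= -(1/4) then -(1/4) else x.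

Definition bandwidth (R : realType) (alpha : R) (n : nat) : R :=
  (n%:R) `^ (- alpha).

Definition ghat d (T : measurableType d) (R : realType) (K : R -> R) (alpha : R)
  (X : nat -> T -> R) (n : nat) (w : T) (x : R) : R :=
  (n%:R)^-1 * \sum_(1 <= i < n.+1)
     ((bandwidth alpha i)^-1 * K ((X i w - x) / bandwidth alpha i)).

Definition That d (T : measurableType d) (R : realType) (K : R -> R) (alpha : R)
  (X Y : nat -> T -> R) (n : nat) (th : R) (w : T) : R :=
  sin (2 * pi * (X n.+1 w - th)) / ghat K alpha X n w (X n.+1 w) * Y n.+1 w.

Definition pre_step d (T : measurableType d) (R : realType) (K : R -> R)
  (alpha f1 : R) (X Y : nat -> T -> R) (n : nat) (th : R) (w : T) : R :=
  th + Num.sg f1 * (n.+1%:R)^-1 * That K alpha X Y n th w.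

(* theta_1 = th1, theta_{n+1} = pi_C(pre_step n theta_n) for n >= 1;
   theta_0 is unused and set to th1 *)
Fixpoint theta_hat d (T : measurableType d) (R : realType) (K : R -> R)
  (alpha f1 th1 : R) (X Y : nat -> T -> R) (n : nat) (w : T) : R :=
  match n with
  | 0 => th1
  | m.+1 => if m is 0 then th1
            else projC (pre_step K alpha f1 X Y m
                          (theta_hat K alpha f1 th1 X Y m w) w)
  end.

(* Main.v *)
(* The increment of the algorithm is f1 * sin (2 pi (theta - theta_n)) plus an error.
   With the density estimate truncated below, the error splits into two bounded-in-L^2
   sequences that are orthogonal given the past (one from X_{n+1}, one from eps_{n+1})
   and a bias dominated by the conditional mean of |ghat_n - g| at X_{n+1}.  Weighted by
   1/n, the orthogonal parts form almost surely convergent series, and so does the bias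
   because E |ghat_n - g| = O(n^(-beta)) for some beta > 0.  A Chernoff bound for ghat_n
   and Borel-Cantelli show that the truncation is eventually inactive.  What remains is
   deterministic: a projected recursion whose drift pulls toward theta, whose gains 1/n
   have a divergent sum and whose perturbation series converges.  As theta is interior
   to C, the unprojected steps eventually stay in C. *)
Require Import Defs.
From HB Require Import structures.
From mathcomp Require Import all_boot all_order all_algebra.
From mathcomp Require Import all_classical all_reals all_analysis measurable_realfun.
From mathcomp Require Import ring lra.
Import Order.TTheory GRing.Theory Num.Theory.
Import numFieldNormedType.Exports.
Local Open Scope classical_set_scope.
Local Open Scope ring_scope.
Set Implicit Arguments. Unset Strict Implicit. Unset Printing Implicit Defensive.

(** * Real sequences and series *)

(** Conditioning on the past is done without conditional expectations. The past is the identity map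
    of T into T with a smaller sigma-algebra; this map is independent of the next draw, so Tonelli
    on the product law integrates the next draw with the past frozen. X_n and eps_n are revealed one
    after the other, so that the noise is still centered once X_{n+1} is known.

    Division by the density is what makes the drift explicit: g cancels from the mean of the
    increment and leaves the integral over one period of sin(2 pi (x - t)) f(x - theta), which
    evenness and periodicity of f turn into f1 sin(2 pi (theta - t)).

    The density jumps from a positive value to 0 at -1/2 and 1/2, so the kernel bias does not vanish
    uniformly. The affected points lie in two layers of width O(h), hence the error is controlled in
    mean only, which is all that the bias term needs. Near an endpoint up to half of the kernel mass
    falls where g is 0: with gmin the minimum of g on its support, the smoothed density is only
    known to be at least gmin/2, and the truncation level gmin/4 is half of that. *)

Section real_sequences.
Context {R : realType}.
Implicit Types (u v e d : R ^nat) (b : R).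

(* Divergence of the gains brings d below eta infinitely often; between two such
   visits it can rise only by the oscillation of the convergent series e. *)
Lemma one_sided_descent N0 d e (gamma : R ^nat) (rho : R -> R) (hi A : R) :
  (forall n, (N0 <= n)%N ->
     d n.+1 <= 0 \/ d n.+1 <= d n + e n - gamma n * rho (d n)) ->
  (forall n, d n <= hi) ->
  (forall x, 0 <= x <= hi -> 0 <= rho x) ->
  (forall eta, 0 < eta ->
     exists2 k, 0 < k & forall x, eta <= x <= hi -> k <= rho x) ->
  (forall x, `|rho x| <= A) ->
  (forall n, 0 <= gamma n) -> gamma @ \oo --> 0 ->
  (forall B, exists n, B < series gamma n) ->
  cvgn (series e) ->
  forall eta, 0 < eta -> exists N, forall n, (N <= n)%N -> d n <= eta.
Proof.
move=> dS dhi rho0 rho_pos rhoA g0 gcvg gdvg /cvg_ex[l ecvg] eta eta0.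
have A0 : 0 <= A by apply: le_trans (rhoA 0).
(* One third of eta is the level that d has to reach, one pays for the overshoot of a step starting
   below 0, where [rho] may be negative, and one for the oscillation of [series e]. *)
have eta3 : 0 < eta / 3 by lra.
have eta6 : 0 < eta / 6 by lra.
have etaA : 0 < eta / 3 / (A + 1) by rewrite divr_gt0//; lra.
move/cvgrPdist_le : ecvg => /(_ _ eta6)[N1 _ HN1].
move/cvgrPdist_le : gcvg => /(_ _ etaA)[N2 _ HN2].
pose N := maxn N0 (maxn N1 N2).
have osc m n : (N <= m)%N -> (N <= n)%N -> series e n - series e m <= eta / 3.
  move=> Nm Nn.
  have H1 := HN1 m (leq_trans (leq_trans (leq_maxl _ _) (leq_maxr _ _)) Nm).
  have H2 := HN1 n (leq_trans (leq_trans (leq_maxl _ _) (leq_maxr _ _)) Nn).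
  by move: H1 H2; rewrite /= !ler_norml => /andP[? ?] /andP[? ?]; lra.
have gA n x : (N <= n)%N -> gamma n * - rho x <= eta / 3.
  move=> Nn.
  have := HN2 n (leq_trans (leq_trans (leq_maxr _ _) (leq_maxr _ _)) Nn).
  rewrite /= sub0r normrN ger0_norm// ler_pdivlMr; last lra.
  move=> H; apply: le_trans H; rewrite ler_wpM2l//.
  by have := rhoA x; rewrite ler_norml => /andP[? ?]; lra.
have N0N n : (N <= n)%N -> (N0 <= n)%N by apply: leq_trans; rewrite leq_maxl.
have [m Nm dm] : exists2 m, (N <= m)%N & d m <= eta / 3.
  apply: contrapT => Hno.
  have big n : (N <= n)%N -> eta / 3 < d n.
    by move=> Nn; rewrite ltNge; apply/negP => H; apply: Hno; exists n.
  have [k k0 rhok] := rho_pos _ eta3.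
  have rec n : d (N + n)%N <= d N + (series e (N + n)%N - series e N)
      - k * (series gamma (N + n)%N - series gamma N).
    elim: n => [|n IH]; first by rewrite addn0; lra.
    rewrite addnS !seriesSr.
    have Nn : (N <= N + n)%N by rewrite leq_addr.
    have Nn1 : (N <= (N + n).+1)%N by rewrite ltnW.
    have [|] := dS _ (N0N _ Nn); first by move: (big _ Nn1); lra.
    have : k <= rho (d (N + n)%N) by apply: rhok; rewrite dhi ltW// big.
    have := g0 (N + n)%N; nra.
  have [n] := gdvg (series gamma N + (hi + eta) / k).
  have [nN|Nn] := leqP n N.
    move=> H; have : series gamma n <= series gamma N.
      by apply: (nondecreasing_series (P := xpredT) (m := 0%N)) => // i _ _; exact: g0.
    have : 0 < (hi + eta) / k.
      by rewrite divr_gt0//; move: (dhi N) (big N (leqnn _)); lra.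
    by lra.
  rewrite -(subnKC (ltnW Nn)) -ltrBrDl.
  set j := (N + (n - N))%N; move=> H.
  have Nj : (N <= j)%N by rewrite leq_addr.
  have H2 : hi + eta < k * (series gamma j - series gamma N).
    by rewrite -ltr_pdivrMl// mulrC; lra.
  have := rec (n - N)%N; rewrite -/j; have := osc _ _ (leqnn N) Nj.
  have := big _ Nj; have := dhi N; lra.
(* The index j is [m] or the latest reset, at a nonpositive value of d. While d is nonnegative the
   drift only helps and is dropped, so that the rise of d since j is at most that of [series e]. *)
have inv n : exists j, [/\ (m <= j)%N, (j <= m + n)%N &
    d (m + n)%N <= eta / 3 + eta / 3 + (series e (m + n)%N - series e j)].
  elim: n => [|n [j [mj jn IH]]].
    by exists m; rewrite addn0 leqnn; split=> //; lra.
  have Nn : (N <= m + n)%N by rewrite (leq_trans Nm)// leq_addr.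
  rewrite addnS; have [dn|] := dS _ (N0N _ Nn).
    exists (m + n).+1; split=> //; [by rewrite (leq_trans (leq_addr n m))|lra].
  have [dn0|dn0] := leP 0 (d (m + n)%N).
    exists j; split=> //; first exact: ltnW.
    rewrite seriesSr; have : 0 <= gamma (m + n)%N * rho (d (m + n)%N).
      by rewrite mulr_ge0// rho0// dn0 dhi.
    by lra.
  exists (m + n)%N; split=> //; first by rewrite leq_addr.
  by rewrite seriesSr; have := gA _ (d (m + n)%N) Nn; lra.
exists m => n mn; have [j [mj jn]] := inv (n - m)%N; rewrite subnKC// in jn *.
by have := osc _ _ (leq_trans Nm mj) (leq_trans Nm mn); lra.
Qed.

Lemma cube_block (J n : nat) : (J ^ 3 <= n)%N ->
  exists j, [/\ (J <= j)%N, (j ^ 3 <= n)%N & (n < j.+1 ^ 3)%N].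
Proof.
elim: n => [|n IH] Jn.
  by exists 0%N; move: Jn; rewrite leqn0 expn_eq0 andbT => /eqP ->.
have [Jn'|Jn'] := leqP (J ^ 3) n.
  have [j [Jj jn nj]] := IH Jn'.
  have [H|H] := leqP (j.+1 ^ 3) n.+1; last first.
    by exists j; split=> //; rewrite (leq_trans jn).
  by exists j.+1; split=> //; [exact: leqW|rewrite (leq_ltn_trans nj)// ltn_exp2r].
by exists J; split=> //; rewrite (leq_ltn_trans Jn')// ltn_exp2r.
Qed.

(** By the first hypothesis the partial sums converge along the cubes; by the second they deviate
    from the value at the preceding cube by a quantity that tends to 0. *)
Lemma cube_block_cvg u :
  cvgn (series (fun j => `|\sum_(j ^ 3 <= k < j.+1 ^ 3) u k|)) ->
  (fun j => \sum_(j ^ 3 <= k < j.+1 ^ 3) `|u k|) @ \oo --> 0 ->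
  cvgn (series u).
Proof.
move=> H1 H2.
have S3 j : series (fun j => \sum_(j ^ 3 <= k < j.+1 ^ 3) u k) j
    = series u (j ^ 3)%N.
  elim: j => [|j IH]; first by rewrite /series/= !big_geq.
  rewrite seriesSr IH /series /= -big_cat_nat//=.
  by rewrite leq_exp2r.
have /cvg_ex[l Hl] : cvgn (series (fun j => \sum_(j ^ 3 <= k < j.+1 ^ 3) u k)).
  exact: normed_cvg.
apply/cvg_ex; exists l; apply/cvgrPdist_le => /= eps eps0.
have eps2 : 0 < eps / 2 by lra.
move/cvgrPdist_le : Hl => /(_ _ eps2)[J1 _ HJ1].
move/cvgrPdist_le : H2 => /(_ _ eps2)[J2 _ HJ2].
exists (maxn J1 J2 ^ 3)%N => // n /= /cube_block[j [Jj jn nj]].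
have := HJ1 j (leq_trans (leq_maxl _ _) Jj); rewrite /= S3 => K1.
have := HJ2 j (leq_trans (leq_maxr _ _) Jj); rewrite /= sub0r normrN => K2.
have K3 : `|series u n - series u (j ^ 3)%N| <= eps / 2.
  rewrite sub_series_geq//; apply: le_trans K2; apply: le_trans (ler_norm _).
  apply: le_trans (ler_norm_sum _ _ _) _.
  by rewrite [leRHS](@big_cat_nat _ _ _ n)//= ?lerDl ?sumr_ge0// ltnW.
by move: K1 K3; rewrite !ler_norml => /andP[? ?] /andP[? ?]; lra.
Qed.

(** Telescoping replaces the integral test: b (n+2)^(-1-b) is at most (n+1)^(-b) - (n+2)^(-b), by
    [1 + x <= expR x] and the tangent bound on the logarithm. *)
Lemma pseries_cvg b : 0 < b ->
  cvgn (series (fun n => n.+1%:R `^ (- (1 + b)) : R)).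
Proof.
move=> b0.
pose v n : R := n.+1%:R `^ (- b).
have step n : b * n.+2%:R `^ (- (1 + b)) <= v n - v n.+1.
  have -> : v n = v n.+1 * expR (b * (- ln (n.+1%:R / n.+2%:R))).
    rewrite /v /powR !gt_eqF// -expRD; congr expR.
    by rewrite ln_div ?posrE//; ring.
  have -> : n.+2%:R `^ (- (1 + b)) = (n.+2%:R)^-1 * v n.+1.
    by rewrite /v opprD powRD ?pnatr_eq0 ?implybT// powR_inv1// ler0n.
  have : (n.+2%:R)^-1 <= - ln (n.+1%:R / n.+2%:R) :> R.
    rewrite lerNr.
    have -> : n.+1%:R / n.+2%:R = 1 + - (n.+2%:R)^-1 :> R.
      by rewrite -[n.+1%:R](addrK 1) natr1 mulrBl mulfV ?gt_eqF// mul1r.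
    apply: le_ln1Dx; rewrite ltrN2 invf_lt1// ltr1n//.
  move=> H; have := expR_ge1Dx (b * - ln (n.+1%:R / n.+2%:R)).
  have := powR_ge0 (n.+2%:R : R) (- b); rewrite -/(v n.+1).
  set w := v n.+1; set E := expR _; set L := - ln _ in H *; set i := _^-1 in H *.
  move=> w0 HE; have : b * i <= b * L by rewrite ler_wpM2l// ltW.
  move=> HbL; rewrite -[leRHS]/(w * E - w).
  have : w * (1 + b * i) <= w * E by rewrite ler_wpM2l//; lra.
  lra.
apply: nondecreasing_is_cvgn.
  by apply: nondecreasing_series => i _ _; rewrite powR_ge0.
exists (1 + b^-1) => _ [n _ <-].
apply: (@le_trans _ _ (1 + b^-1 * (v 0%N - v n))); last first.
  rewrite lerD2l ler_piMr ?invr_ge0 ?(ltW b0)// /v powR1.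
  by rewrite lerBlDr lerDl powR_ge0.
suff H m : series (fun n => n.+1%:R `^ (- (1 + b)) : R) m.+1
    <= 1 + b^-1 * (v 0%N - v m).
  case: n => [|n].
    by rewrite /series/= big_geq// subrr mulr0 addr0.
  apply: le_trans (H n) _; rewrite lerD2l ler_wpM2l ?invr_ge0 ?(ltW b0)//.
  rewrite lerB// -subr_ge0; apply: le_trans (step n).
  by rewrite mulr_ge0 ?powR_ge0// ltW.
elim: m => [|m IH].
  by rewrite /series /= big_nat1 powR1 subrr mulr0 addr0.
rewrite seriesSr; have := step m; rewrite -ler_pdivlMl//; move: IH; lra.
Qed.

(** Bernoulli's inequality for exponents at most 1, from convexity of the exponential between [ln t]
    and 0. *)
Lemma bernoulli_powR (a t : R) : 0 <= a <= 1 -> 0 < t ->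
  t `^ a <= 1 - a * (1 - t).
Proof.
move=> /andP[a0 a1] t0; rewrite /powR gt_eqF//.
have := @convex_expR R (Itv01 a0 a1) (ln t) 0.
rewrite !convRE /= mulr0 addr0 expR0 mulr1 lnK ?posrE// /unstable.onem => H.
by apply: le_trans H _; lra.
Qed.

(** The induction step is Bernoulli's inequality at (n+1)/(n+2) with exponent 1 - a. The bound makes
    the average of the first n bandwidths O(n^(-alpha)). *)
Lemma sum_powR_le (a : R) n : 0 < a < 1 ->
  \sum_(1 <= i < n.+1) i%:R `^ (- a) <= (1 - a)^-1 * n%:R `^ (1 - a) :> R.
Proof.
move=> /andP[a0 a1].
have a1' : 0 < 1 - a by lra.
elim: n => [|n IH]; first by rewrite big_geq// mulr_ge0 ?powR_ge0 ?invr_ge0 ?ltW.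
rewrite big_nat_recr//=; apply: le_trans (lerD IH (lexx _)) _.
rewrite -(ler_pM2l a1') mulrDr !mulrA mulfV ?gt_eqF// !mul1r.
case: n {IH} => [|n].
  by rewrite powR0 ?gt_eqF// !powR1; lra.
have x0 : 0 < n.+1%:R :> R by rewrite ltr0n.
have y0 : 0 < n.+2%:R :> R by rewrite ltr0n.
have := @bernoulli_powR (1 - a) (n.+1%:R / n.+2%:R) _ (divr_gt0 x0 y0).
rewrite (ltW a1')/= => /(_ _)/wrap[]; first by lra.
rewrite powRM ?invr_ge0 ?(ltW x0) ?(ltW y0)//.
have -> : (n.+2%:R^-1 : R) `^ (1 - a) = (n.+2%:R `^ (1 - a))^-1.
  by rewrite -powR_inv1 ?(ltW y0)// -powRrM mulN1r powRN.
rewrite ler_pdivrMr ?powR_gt0// => H.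
have -> : n.+2%:R `^ (- a) = n.+2%:R^-1 * n.+2%:R `^ (1 - a) :> R.
  by rewrite powRD ?pnatr_eq0 ?implybT// powRr1 ?ler0n// mulrA mulVf ?gt_eqF// mul1r.
have e : n.+1%:R / n.+2%:R = 1 - n.+2%:R^-1 :> R.
  by rewrite -[n.+1%:R](addrK 1) natr1 mulrBl mulfV ?gt_eqF// mul1r.
apply: le_trans (lerD H (lexx _)) _; rewrite e.
by rewrite le_eqVlt; apply/orP; left; apply/eqP; ring.
Qed.

Lemma expR_powR_summable (c b : R) : 0 < c -> 0 < b ->
  cvgn (series (fun n => expR (- (c * n.+1%:R `^ b)))).
Proof.
move=> c0 b0.
(* The inequality (y/m)^m <= exp y turns exponential decay into a power of exponent at least m b;
   this m makes that exponent at least 2. *)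
pose m := (Num.truncn (2 / b)).+1.
have mb : 2 <= m%:R * b.
  by rewrite -ler_pdivrMr// ltW// truncnS_gt.
have m0 : 0 < m%:R :> R by rewrite ltr0n.
pose C := (m%:R / c) ^+ m.
apply: (@series_le_cvg R _ (fun n => C * n.+1%:R `^ (- (1 + 1)))) => [n|n|n|].
- exact: expR_ge0.
- by rewrite mulr_ge0 ?powR_ge0// exprn_ge0// divr_ge0 ?ltW.
- have x0 : 0 < n.+1%:R :> R by rewrite ltr0n.
  have x1 : 1 <= n.+1%:R :> R by rewrite ler1n.
  set x := n.+1%:R : R in x0 x1 *.
  rewrite expRN; set y := c * _.
  have y0 : 0 < y by rewrite mulr_gt0// powR_gt0.
  have H : (y / m%:R) ^+ m <= expR y.
    have -> : expR y = expR (y / m%:R) ^+ m.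
      by rewrite -expRM_natr mulfVK ?gt_eqF.
    rewrite lerXn2r ?nnegrE ?expR_ge0 ?divr_ge0 ?ltW//.
    by apply: lt_le_trans (expR_ge1Dx _); rewrite ltrDr.
  have ym0 : 0 < (y / m%:R) ^+ m by rewrite exprn_gt0// divr_gt0.
  apply: (@le_trans _ _ ((y / m%:R) ^+ m)^-1).
    by rewrite lef_pV2 ?posrE ?expR_gt0.
  rewrite (_ : _^-1 = C * x `^ (- (b * m%:R))); last first.
    rewrite powRN powRrM powR_mulrn ?powR_ge0// -exprVn invf_div /C /y.
    by rewrite -exprVn -exprMn invfM mulrA.
  rewrite ler_wpM2l ?exprn_ge0 ?divr_ge0 ?(ltW m0) ?(ltW c0)//.
  by apply: ler_powR => //; rewrite lerN2 mulrC.
- apply: (@is_cvg_seriesZ _ (fun n => n.+1%:R `^ (- (1 + 1)) : R) C).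
  exact: pseries_cvg.
Qed.

End real_sequences.

(** * Almost sure convergence of random series *)

Section integral_lemmas.
Context d (T : measurableType d) (R : realType).

(** The sum has a finite integral by monotone convergence, so it is finite almost everywhere.
    Applied to indicators this is the Borel-Cantelli lemma. *)
Lemma ae_series_cvg (mu : {measure set T -> \bar R}) (u : nat -> T -> R) (b : R ^nat) :
  (forall n, measurable_fun setT (u n)) -> (forall n w, 0 <= u n w) ->
  (forall n, (\int[mu]_w (u n w)%:E <= (b n)%:E)%E) -> cvgn (series b) ->
  {ae mu, forall w, cvgn (series (u ^~ w))}.
Proof.
move=> mu_ u0 ub cb.
have bfin : (\sum_(n <oo) (b n)%:E < +oo)%E.
  rewrite (_ : (fun n => _) = EFin \o series b); last first.
    by apply/funext => n /=; rewrite sumEFin.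
  by rewrite EFin_lim// ltry.
have mS : measurable_fun setT (fun w => (\sum_(n <oo) (u n w)%:E)%E : \bar R).
  apply: ge0_emeasurable_sum => // [n w _ _|n _]; first by rewrite lee_fin.
  exact/measurable_EFinP.
have iS : mu.-integrable setT (fun w => (\sum_(n <oo) (u n w)%:E)%E : \bar R).
  apply/integrableP; split=> //.
  under eq_integral.
    move=> w _; rewrite gee0_abs; last by apply: nneseries_ge0 => n _ _; rewrite lee_fin.
    over.
  rewrite integral_nneseries//=; last 2 first.
  - by move=> n; exact/measurable_EFinP.
  - by move=> n w _; rewrite lee_fin.
  apply: le_lt_trans bfin; apply: lee_nneseries => // n _ _.
  by apply: integral_ge0 => w _; rewrite lee_fin.
have := integrable_ae measurableT iS.
apply: filterS => w /(_ I) Sw; apply: nnseries_is_cvg => //.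
by rewrite ltey_eq Sw.
Qed.

Lemma Rintegral_sum (mu : {measure set T -> \bar R}) (I : Type) (s : seq I)
    (f : I -> T -> R) :
  (forall i, mu.-integrable setT (EFin \o f i)) ->
  \int[mu]_w (\sum_(i <- s) f i w) = \sum_(i <- s) \int[mu]_w f i w.
Proof.
move=> fi; elim: s => [|i s IH].
  rewrite big_nil; under eq_Rintegral do rewrite big_nil.
  by rewrite Rintegral_cst// mul0r.
rewrite big_cons -IH -RintegralD//.
  by apply: eq_Rintegral => w _; rewrite big_cons.
rewrite (_ : _ \o _ = fun w => \sum_(j <- s) (EFin \o f j) w)%E.
  exact: integrable_sum.
by apply/funext => w /=; rewrite sumEFin.
Qed.

Lemma integrable_mul_of_sqr (mu : {measure set T -> \bar R}) (f g : T -> R) :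
  measurable_fun setT f -> measurable_fun setT g ->
  (\int[mu]_w (f w ^+ 2)%:E < +oo)%E -> (\int[mu]_w (g w ^+ 2)%:E < +oo)%E ->
  mu.-integrable setT (EFin \o (f \* g)).
Proof.
move=> mf mg f2 g2.
have mf2 : measurable_fun setT (fun w => f w ^+ 2) by exact: measurable_funX.
have mg2 : measurable_fun setT (fun w => g w ^+ 2) by exact: measurable_funX.
have sqr_int (h : T -> R) : measurable_fun setT (fun w => h w ^+ 2) ->
    (\int[mu]_w (h w ^+ 2)%:E < +oo)%E ->
    mu.-integrable setT (fun w => (h w ^+ 2)%:E : \bar R).
  move=> mh hoo; apply/integrableP; split; first exact/measurable_EFinP.
  by under eq_integral do rewrite gee0_abs ?lee_fin ?sqr_ge0//.
apply: (le_integrable measurableT _ _ (integrableD measurableT (sqr_int f mf2 f2) (sqr_int g mg2 g2))).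
  by apply/measurable_EFinP; exact: measurable_funM.
move=> w _; rewrite /= lee_fin [leRHS]ger0_norm ?addr_ge0 ?sqr_ge0//.
rewrite normrM -(real_normK (num_real (f w))) -(real_normK (num_real (g w))).
have := normr_ge0 (f w); have := normr_ge0 (g w).
by move: `|f w| `|g w| => x y; nra.
Qed.

Lemma orthogonal_sum_sqr (mu : {measure set T -> \bar R}) (Z : nat -> T -> R)
    (s : seq nat) : uniq s ->
  (forall k, measurable_fun setT (Z k)) ->
  (forall k, (\int[mu]_w (Z k w ^+ 2)%:E < +oo)%E) ->
  (forall j k, (j < k)%N -> \int[mu]_w (Z j w * Z k w) = 0) ->
  (\int[mu]_w ((\sum_(k <- s) Z k w) ^+ 2)%:E =
   \sum_(k <- s) \int[mu]_w (Z k w ^+ 2)%:E)%E.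
Proof.
move=> us mZ Z2 Z0.
have iZ j k : mu.-integrable setT (EFin \o (Z j \* Z k)).
  exact: integrable_mul_of_sqr.
have iZs j : mu.-integrable setT (EFin \o (fun w => \sum_(k <- s) Z j w * Z k w)).
  rewrite (_ : _ \o _ = fun w => (\sum_(k <- s) (EFin \o (Z j \* Z k)%R) w)%E).
    exact: integrable_sum.
  by apply/funext => w /=; rewrite sumEFin.
have iS : mu.-integrable setT (EFin \o (fun w => (\sum_(k <- s) Z k w) ^+ 2)).
  rewrite (_ : _ \o _ = fun w => \sum_(j <- s)
      (EFin \o (fun w => \sum_(k <- s) Z j w * Z k w)%R) w)%E.
    exact: integrable_sum.
  apply/funext => w /=; rewrite sumEFin expr2 mulr_suml.
  by congr EFin; apply: eq_bigr => i _; rewrite mulr_sumr.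
have -> : (\int[mu]_w ((\sum_(k <- s) Z k w) ^+ 2)%:E
    = (\int[mu]_w ((\sum_(k <- s) Z k w) ^+ 2)%R)%:E)%E.
  by rewrite /Rintegral fineK//; apply: integrable_fin_num.
have -> : \int[mu]_w ((\sum_(k <- s) Z k w) ^+ 2) =
    \int[mu]_w (\sum_(j <- s) \sum_(k <- s) Z j w * Z k w).
  apply: eq_Rintegral => w _; rewrite expr2 mulr_suml.
  by apply: eq_bigr => i _; rewrite mulr_sumr.
rewrite Rintegral_sum// -sumEFin big_seq [RHS]big_seq; apply: eq_bigr => j js.
rewrite (Rintegral_sum s (f := fun k w => Z j w * Z k w)); last by move=> k; exact: iZ.
rewrite (bigD1_seq j)//= big1_seq ?addr0; last first.
  move=> k /andP[kj _]; case: (ltngtP j k) kj => // [jk|kj] _; first exact: Z0.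
  by under eq_Rintegral do rewrite mulrC; exact: Z0.
by rewrite /Rintegral fineK//; apply: (integrable_fin_num measurableT (iZ j j)).
Qed.

End integral_lemmas.

Lemma sqr_sum_le (R : realFieldType) (I : Type) (s : seq I) (x : I -> R) :
  (\sum_(i <- s) x i) ^+ 2 <= (size s)%:R * \sum_(i <- s) x i ^+ 2.
Proof.
elim: s => [|i s IH]; first by rewrite !big_nil mulr0 expr0n.
rewrite !big_cons /= sqrrD -natr1.
have : (x i * \sum_(j <- s) x j) *+ 2 <= (size s)%:R * x i ^+ 2 + \sum_(j <- s) x j ^+ 2.
  rewrite -mulrnAr -sumrMnl mulr_sumr.
  have -> : (size s)%:R * x i ^+ 2 = \sum_(j <- s) x i ^+ 2.
    by rewrite big_const_seq count_predT iter_addr addr0 mulr_natl.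
  rewrite -big_split/=; apply: ler_sum => j _.
  by rewrite -subr_ge0 (_ : _ - _ = (x i - x j) ^+ 2) ?sqr_ge0//; ring.
move: IH; set n := (size s)%:R; set S := \sum_(_ <- _) _; set Q := \sum_(_ <- _) _.
move: (x i ^+ 2) (x i * S) (S ^+ 2) => a b c; lra.
Qed.

(** The factor 4 is that of the convexity bound (x+1)^3 <= 4 (x^3+1), whose defect is 3 (x+1)
    (x-1)^2. *)
Lemma cube_block_weight (R : realFieldType) (j k : nat) : (j ^ 3 <= k)%N ->
  (k.+1%:R)^-1 <= 4 * (j.+1%:R ^- 3) :> R.
Proof.
move=> jk; have x0 : 0 < j.+1%:R :> R by rewrite ltr0n.
rewrite -[leLHS]mul1r ler_pdivrMr ?ltr0n// mulrAC ler_pdivlMr ?exprn_gt0// mul1r.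
apply: (@le_trans _ _ (4 * (j%:R ^+ 3 + 1))); last first.
  by rewrite ler_pM2l// -natrX natr1 ler_nat.
rewrite -natr1; have : 0 <= j%:R :> R by rewrite ler0n.
move: (j%:R : R) => x x_ge0; rewrite -subr_ge0.
rewrite (_ : _ - _ = 3 * ((x + 1) * (x - 1) ^+ 2)); last by ring.
by rewrite mulr_ge0// mulr_ge0 ?sqr_ge0// addr_ge0.
Qed.

Lemma cube_block_size (R : realFieldType) (j : nat) :
  (j.+1 ^ 3 - j ^ 3)%:R <= 3 * j.+1%:R ^+ 2 :> R.
Proof.
rewrite natrB ?leq_exp2r// !natrX -natr1.
have : 0 <= j%:R :> R by rewrite ler0n.
by move: (j%:R : R) => x x_ge0; nra.
Qed.

Section orthogonal_series.
Context d (T : measurableType d) (R : realType) (P : {measure set T -> \bar R}).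

(* The blocks [j^3, (j+1)^3) replace a maximal inequality: the increments of
   the series along the cubes and its total variation inside the blocks are
   both square-summable in L^2. *)
Lemma orthogonal_series_cvg (Z : nat -> T -> R) (C : R) :
  (forall k, measurable_fun setT (Z k)) ->
  (forall k, (\int[P]_w (Z k w ^+ 2)%:E <= C%:E)%E) ->
  (forall j k, (j < k)%N -> \int[P]_w (Z j w * Z k w) = 0) ->
  {ae P, forall w, cvgn (series (fun k => (k.+1%:R)^-1 * Z k w))}.
Proof.
move=> mZ ZC Z0.
have C0 : 0 <= C.
  rewrite -lee_fin; apply: le_trans (ZC 0%N).
  by apply: integral_ge0 => w _; rewrite lee_fin sqr_ge0.
pose Y k w : R := (k.+1%:R)^-1 * Z k w.
have mY k : measurable_fun setT (Y k) by exact: measurable_funM.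
have Zoo k : (\int[P]_w (Z k w ^+ 2)%:E < +oo)%E by apply: le_lt_trans (ltry C).
have EY k : (\int[P]_w (Y k w ^+ 2)%:E <= ((k.+1%:R)^-1 ^+ 2 * C)%:E)%E.
  under eq_integral do rewrite exprMn EFinM.
  rewrite ge0_integralZl//=.
  - by rewrite [leRHS]EFinM lee_wpmul2l// lee_fin sqr_ge0.
  - by apply/measurable_EFinP; exact: measurable_funX.
  - by move=> w _; rewrite lee_fin sqr_ge0.
have Y0 j k : (j < k)%N -> \int[P]_w (Y j w * Y k w) = 0.
  move=> jk; under eq_Rintegral do rewrite /Y mulrACA.
  by rewrite RintegralZl// ?Z0 ?mulr0//; exact: integrable_mul_of_sqr.
pose B j := index_iota (j ^ 3) (j.+1 ^ 3).
have Yoo k : (\int[P]_w (Y k w ^+ 2)%:E < +oo)%E by apply: le_lt_trans (EY k) (ltry _).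
(* A block has at most 3 (j+1)^2 terms, each at most 16 C (j+1)^(-6). *)
have sumB j : (\sum_(k <- B j) ((k.+1%:R)^-1 ^+ 2 * C) <= 48 * C * j.+1%:R ^- 4 :> R).
  apply: (@le_trans _ _ (\sum_(k <- B j) ((4 * (j.+1%:R ^- 3)) ^+ 2 * C))).
    rewrite big_seq [leRHS]big_seq; apply: ler_sum => k.
    rewrite mem_index_iota => /andP[jk _]; rewrite ler_wpM2r//.
    by rewrite lerXn2r ?nnegrE ?mulr_ge0 ?invr_ge0 ?exprn_ge0// cube_block_weight.
  rewrite big_const_seq count_predT iter_addr addr0 size_iota -[leLHS]mulr_natl.
  apply: le_trans (ler_wpM2r _ (cube_block_size R j)) _.
    by rewrite mulr_ge0// sqr_ge0.
  rewrite le_eqVlt; apply/orP; left; apply/eqP; field.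
  by rewrite addrC natr1 pnatr_eq0.
have sq_cvg (a : R) : cvgn (series (fun j => a * j.+1%:R `^ (- (1 + 1)) : R)).
  apply: (@is_cvg_seriesZ _ (fun n => n.+1%:R `^ (- (1 + 1)) : R) a).
  exact: pseries_cvg.
have powE j : j.+1%:R `^ (- (1 + 1)) = j.+1%:R ^- 2 :> R.
  by rewrite -powR_invn.
have mS j : measurable_fun setT (fun w => \sum_(k <- B j) Y k w).
  exact: measurable_sum.
have mA j : measurable_fun setT (fun w => \sum_(k <- B j) `|Y k w|).
  by apply: measurable_sum => k; exact: measurableT_comp.
(* The weight (j+1)^2 leaves a mean of order (j+1)^(-2), still summable. It allows the passage from
   squares to absolute values through |D| <= (x D)^2 + x^(-2) with x = j+1. *)
have ae1 : {ae P, forall w, cvgn (series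
    (fun j => j.+1%:R ^+ 2 * (\sum_(k <- B j) Y k w) ^+ 2))}.
  apply: (@ae_series_cvg _ _ _ _ _ (fun j => 48 * C * j.+1%:R `^ (- (1 + 1)))) => //.
  - by move=> j; apply: measurable_funM => //; exact: measurable_funX.
  - by move=> j w; rewrite mulr_ge0 ?sqr_ge0.
  move=> j; under eq_integral do rewrite EFinM.
  rewrite ge0_integralZl//=; last 2 first.
  - by apply/measurable_EFinP; exact: measurable_funX.
  - by move=> w _; rewrite lee_fin sqr_ge0.
  rewrite orthogonal_sum_sqr ?iota_uniq//.
  apply: (@le_trans _ _ ((j.+1%:R ^+ 2)%:E * (48 * C * j.+1%:R ^- 4)%:E)%E).
    rewrite lee_wpmul2l ?lee_fin ?sqr_ge0//.
    apply: (le_trans (lee_sum _ (fun k _ => EY k))).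
    by rewrite sumEFin lee_fin sumB.
  rewrite -EFinM lee_fin powE le_eqVlt; apply/orP; left; apply/eqP; field.
  by rewrite addrC natr1 pnatr_eq0.
(* Absolute values destroy orthogonality; Cauchy-Schwarz over a block costs its size, at most 3
   (j+1)^2, whence 144 = 3 * 48 and again a summable bound. *)
have ae2 : {ae P, forall w, cvgn (series
    (fun j => (\sum_(k <- B j) `|Y k w|) ^+ 2))}.
  apply: (@ae_series_cvg _ _ _ _ _ (fun j => 144 * C * j.+1%:R `^ (- (1 + 1)))) => //.
  - by move=> j; exact: measurable_funX.
  - by move=> j w; rewrite sqr_ge0.
  move=> j.
  apply: (@le_trans _ _ (\int[P]_w ((3 * j.+1%:R ^+ 2)%:E * \sum_(k <- B j) (Y k w ^+ 2)%:E))%E).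
    apply: ge0_le_integral => //=.
    - by move=> w _; rewrite lee_fin sqr_ge0.
    - by apply/measurable_EFinP; exact: measurable_funX.
    - apply: measurable_funeM; apply: emeasurable_sum => k.
      by apply/measurable_EFinP; exact: measurable_funX.
    move=> w _; rewrite sumEFin -EFinM lee_fin.
    apply: le_trans (sqr_sum_le _ _) _.
    have -> : \sum_(k <- B j) `|Y k w| ^+ 2 = \sum_(k <- B j) Y k w ^+ 2.
      by apply: eq_bigr => k _; rewrite real_normK ?num_real.
    rewrite ler_wpM2r ?sumr_ge0// => [k _|]; first by rewrite sqr_ge0.
    by rewrite size_iota cube_block_size.
  rewrite ge0_integralZl//=; last 2 first.
  - by apply: emeasurable_sum => k; apply/measurable_EFinP; exact: measurable_funX.
  - by move=> w _; apply: sume_ge0 => k _; rewrite lee_fin sqr_ge0.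
  rewrite ge0_integral_sum//; last 2 first.
  - by move=> k; apply/measurable_EFinP; exact: measurable_funX.
  - by move=> k w _; rewrite lee_fin sqr_ge0.
  apply: (@le_trans _ _ ((3 * j.+1%:R ^+ 2)%:E * (48 * C * j.+1%:R ^- 4)%:E)%E).
    rewrite lee_wpmul2l ?lee_fin ?mulr_ge0 ?sqr_ge0//.
    apply: (le_trans (lee_sum _ (fun k _ => EY k))).
    by rewrite sumEFin lee_fin sumB.
  rewrite -EFinM lee_fin powE le_eqVlt; apply/orP; left; apply/eqP; field.
  by rewrite addrC natr1 pnatr_eq0.
move: ae1 ae2; apply: filterS2 => w H1 H2; apply: cube_block_cvg.
  apply: (@series_le_cvg R _ (fun j => j.+1%:R ^+ 2 * (\sum_(k <- B j) Y k w) ^+ 2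
      + j.+1%:R `^ (- (1 + 1)))) => //.
  - by move=> j; rewrite addr_ge0 ?powR_ge0// mulr_ge0 ?sqr_ge0.
  - move=> j; rewrite powE -/(B j).
    have x0 : 0 < j.+1%:R :> R by rewrite ltr0n.
    set x : R := j.+1%:R in x0 *; set D := \sum_(_ <- _) _.
    rewrite -[x ^- 2]exprVn -exprMn.
    have -> : `|D| = (x * `|D|) * x^-1 by rewrite mulrAC mulfV ?mul1r// gt_eqF.
    rewrite -(real_normK (num_real (x * D))) normrM (gtr0_norm x0).
    have : 0 <= x^-1 by rewrite invr_ge0 ltW.
    have : 0 <= x * `|D| by rewrite mulr_ge0// ltW.
    by move: (x * `|D|) (x^-1) => p q; nra.
  - rewrite (_ : (fun j => _) = (fun j => j.+1%:R ^+ 2 * (\sum_(k <- B j) Y k w) ^+ 2)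
      + (fun j => j.+1%:R `^ (- (1 + 1))))//.
    by apply: is_cvg_seriesD => //; exact: pseries_cvg.
have := cvg_series_cvg_0 H2.
move=> /cvgrPdist_le H; apply/cvgrPdist_le => e e0.
have := H _ (exprn_gt0 2 e0); apply: filterS => j.
rewrite !sub0r !normrN normrX.
by rewrite ler_pXn2r// nnegrE// ltW.
Qed.

End orthogonal_series.

(** * Independence of the past *)

Section freezing.
Context d (T : measurableType d) (R : realType) (P : probability T R).
Context dE (E : measurableType dE) (W : {RV P >-> E}) (X : {RV P >-> R}).
Hypothesis WX : forall A B, measurable A -> measurable B ->
  P (W @^-1` A `&` X @^-1` B) = (P (W @^-1` A) * P (X @^-1` B))%E.

Lemma ge0_freezing (psi : E * R -> \bar R) :
  measurable_fun setT psi -> (forall z, 0 <= psi z)%E ->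
  (\int[P]_w psi (W w, X w) = \int[P]_w \int[P]_w' psi (W w, X w'))%E.
Proof.
move=> mpsi psi0.
have mV : measurable_fun setT (fun w => (W w, X w)).
  by apply: measurable_fun_pair.
pose V : {RV P >-> (E * R)%type} := HB.pack (fun w => (W w, X w))
  (isMeasurableFun.Build _ _ _ _ _ mV).
have e A : measurable A ->
    (distribution P W \x distribution P X)%E A = distribution P V A.
  by apply: product_measure_unique => B C mB mC; exact: WX.
transitivity (\int[distribution P V]_z psi z)%E.
  by rewrite ge0_integral_distribution.
transitivity (\int[(distribution P W \x distribution P X)%E]_z psi z)%E.
  apply: eq_measure_integral => A mA _; first [exact: e|exact/esym/e].
rewrite fubini_tonelli1// ge0_integral_distribution//=.
- apply: eq_integral => w _; rewrite /fubini_F ge0_integral_distribution//.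
  exact: measurable_fun_pair2.
- by apply: measurable_fun_fubini_tonelli_F.
- by move=> e0; apply: integral_ge0.
Qed.

(** Freezing is applied to the positive and the negative part: for each value of [W] their inner
    integrals are finite and equal, hence so are the full integrals. Every orthogonality relation
    below is an instance. *)
Lemma freezing_centered (psi : E * R -> R) :
  measurable_fun setT psi ->
  P.-integrable setT (fun w => (psi (W w, X w))%:E) ->
  (forall e, P.-integrable setT (fun w => (psi (e, X w))%:E)) ->
  (forall e, \int[P]_w psi (e, X w) = 0) ->
  \int[P]_w psi (W w, X w) = 0.
Proof.
move=> mpsi ipsi iX X0.
pose phi := EFin \o psi.
have mphi : measurable_fun setT phi by exact/measurable_EFinP.
have pn : (\int[P]_w (phi^\+ (W w, X w)) = \int[P]_w (phi^\- (W w, X w)))%E.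
  rewrite (ge0_freezing (psi := (phi^\+)%E))//; last exact: measurable_funepos.
  rewrite (ge0_freezing (psi := (phi^\-)%E))//; last exact: measurable_funeneg.
  apply: eq_integral => w _.
  have fp := integrable_pos_fin_num measurableT (iX (W w)).
  have fn := integrable_neg_fin_num measurableT (iX (W w)).
  have key (a c : \bar R) : a \is a fin_num -> c \is a fin_num ->
      fine (a - c)%E = 0 -> a = c.
    by move: a c => [a||] [c||]//= _ _ /eqP; rewrite subr_eq0 => /eqP ->.
  have := X0 (W w); rewrite /Rintegral integralE => H.
  have := key _ _ fp fn H; rewrite !(funepos_comp phi (fun w' => (W w, X w'))).
  by rewrite (funeneg_comp phi (fun w' => (W w, X w'))).
rewrite /Rintegral integralE (funepos_comp phi (fun w => (W w, X w))).
rewrite (funeneg_comp phi (fun w => (W w, X w))).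
have := integrable_neg_fin_num measurableT ipsi.
rewrite (funeneg_comp phi (fun w => (W w, X w))) => fn.
by rewrite [X in (X - _)%E]pn subee.
Qed.

End freezing.

Section past.
Context d (T : measurableType d) (R : realType) (P : probability T R).
Context (I : eqType) (Z : I -> {RV P >-> R}).
Hypothesis indep : mutually_independent P (fun i => Z i : T -> R).
Variable J : pred I.

(** A pi-system of events constraining finitely many coordinates in [J]. The empty list gives the
    whole space, as the uniqueness theorem for finite measures requires. *)
Definition cylinders : set (set T) := [set A | exists (s : seq I) (B : I -> set R),
  [/\ uniq s, forall i, i \in s -> J i, forall i, measurable (B i) &
      A = \bigcap_(i in [set` s]) (Z i @^-1` B i)]].

(* T with the sigma-algebra generated by the Z i, i in J. *)
Definition past := g_sigma_algebraType cylinders.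

Lemma cylinders_setI : setI_closed cylinders.
Proof.
move=> _ _ [s [B [us sJ mB ->]]] [t [C [ut tJ mC ->]]].
pose D i := (if i \in s then B i else setT) `&` (if i \in t then C i else setT).
exists (undup (s ++ t)), D; split; first exact: undup_uniq.
- by move=> i; rewrite mem_undup mem_cat => /orP[/sJ|/tJ].
- by move=> i; apply: measurableI; case: ifPn.
apply/seteqP; split=> [w [Hs Ht] i|w H].
  rewrite /= mem_undup mem_cat => _; rewrite /D.
  by split; case: ifPn => // ii; [exact: Hs|exact: Ht].
split=> i /= ii.
  by have := H i; rewrite /= mem_undup mem_cat ii /D/= ii => /(_ isT)[].
by have := H i; rewrite /= mem_undup mem_cat ii orbT /D/= ii => /(_ isT)[].
Qed.

Lemma cylinders_measurable : cylinders `<=` measurable.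
Proof.
move=> _ [s [B [us sJ mB ->]]]; apply: fin_bigcap_measurable => [|i _].
  exact: finite_seq.
by rewrite -[_ @^-1` _]setTI; exact: measurable_funP.
Qed.

Lemma measurable_past (A : set T) : measurable (A : set past) -> measurable A.
Proof.
move: A; apply: smallest_sub; last exact: cylinders_measurable.
exact: sigma_algebra_measurable.
Qed.

Lemma past_measurable i : J i -> measurable_fun setT (Z i : past -> R).
Proof.
move=> Ji _ B mB; rewrite setTI; apply: sub_sigma_algebra.
exists [:: i], (fun=> B); split=> // [j|]; first by rewrite inE => /eqP ->.
by rewrite set_cons1 bigcap_set1.
Qed.

(** Since [i0] lies outside [J], it does not occur in [s]; the product formula for [i0 :: s],
    divided into its head and the formula for [s], is the claim. *)
Lemma cylinders_indep i0 (B : set R) A : ~~ J i0 -> measurable B -> cylinders A ->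
  P (A `&` Z i0 @^-1` B) = (P A * P (Z i0 @^-1` B))%E.
Proof.
move=> nJ mB [s [C [us sJ mC ->]]].
have i0s : i0 \notin s by apply: contra nJ => /sJ.
pose D i := if i == i0 then B else C i.
have De i : i \in s -> D i = C i.
  by move=> ii; rewrite /D; case: eqP => // e; move: i0s; rewrite -e ii.
have := indep (s := i0 :: s) (B := D).
rewrite /= i0s us => /(_ isT)/(_ _)/wrap[].
  by move=> i _; rewrite /D; case: ifP.
have := indep (s := s) (B := C) us (fun i _ => mC i).
have DB : D i0 = B by rewrite /D eqxx.
move=> ->; rewrite big_cons DB => H; rewrite muleC.
rewrite [in RHS](eq_big_seq (fun i => P (Z i @^-1` D i))); last first.
  by move=> i ii; rewrite De.
rewrite -[RHS]H; congr (P _); apply/seteqP; split=> [w [H1 H2] i /=|w Hw].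
  rewrite inE => /orP[/eqP ->|ii]; first by rewrite DB.
  by rewrite De//; exact: H1.
split=> [i /= ii|]; first by rewrite -De//; apply: Hw; rewrite /= inE ii orbT.
by have := Hw i0; rewrite /= inE eqxx DB; apply.
Qed.

(** The identity into the coarser sigma-algebra presents the whole past as a single random variable,
    which can serve as [W] in the freezing lemmas. *)
Definition past_id : T -> past := fun w => w.

Lemma measurable_past_id : measurable_fun setT past_id.
Proof. by move=> _ A mA; rewrite setTI; exact: measurable_past. Qed.

HB.instance Definition _ := isMeasurableFun.Build _ _ _ _ past_id measurable_past_id.

(** For fixed B both sides are finite measures in A; they agree on the pi-system of cylinders, hence
    on the sigma-algebra it generates. *)
Lemma past_indep i0 : ~~ J i0 -> forall (A : set past) (B : set R),
  measurable A -> measurable B ->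
  P (past_id @^-1` A `&` Z i0 @^-1` B) = (P (past_id @^-1` A) * P (Z i0 @^-1` B))%E.
Proof.
move=> nJ A B mA mB.
have mZB : measurable (Z i0 @^-1` B).
  by rewrite -[_ @^-1` _]setTI; exact: measurable_funP.
have k0 : 0 <= fine (P (Z i0 @^-1` B)) by rewrite fine_ge0.
pose m1 : {measure set T -> \bar R} := mrestr P mZB.
pose m2 : {measure set T -> \bar R} := mscale (NngNum k0) P.
have -> : P (past_id @^-1` A) = P A by [].
transitivity (m1 A) => //.
transitivity (m2 A); last first.
  rewrite /m2 /= /mscale /= muleC fineK//; exact: fin_num_measure.
apply: (g_sigma_algebra_measure_unique cylinders _ (fun=> setT)) => //.
- exact: cylinders_measurable.
- move=> _; exists [::], (fun=> setT); split=> //.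
  by rewrite set_nil bigcap_set0.
- by rewrite bigcup_const//; exists 0%N.
- exact: cylinders_setI.
- move=> C CC; rewrite /m1 /m2 /= /mrestr /mscale /= cylinders_indep//.
  by rewrite muleC fineK//; exact: fin_num_measure.
- move=> _; rewrite /m1 /= /mrestr; apply: le_lt_trans (ltry 1).
  by apply: probability_le1; exact: measurableI.
Qed.

End past.

(** * Change of measure: densities and affine substitutions *)

Section density.
Context d (T : measurableType d) (R : realType).
Variables (mu nu : {measure set T -> \bar R}) (g : T -> R).
Hypothesis mg : measurable_fun setT g.
Hypothesis g0 : forall x, 0 <= g x.
Hypothesis nuE : forall A, measurable A -> nu A = (\int[mu]_(x in A) (g x)%:E)%E.

Import HBNNSimple.

(** Monotone convergence along simple functions reduces the claim to level sets, where it is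
    [nuE]. *)
Lemma ge0_integral_density (f : T -> \bar R) :
  measurable_fun setT f -> (forall x, 0 <= f x)%E ->
  (\int[nu]_x f x = \int[mu]_x (f x * (g x)%:E))%E.
Proof.
move=> mf f0; pose f_ := nnsfun_approx measurableT mf.
have cvgf x : EFin \o f_ ^~ x @ \oo --> f x by apply: cvg_nnsfun_approx.
transitivity (limn (fun n => \int[nu]_x (f_ n x)%:E))%E.
  rewrite -monotone_convergence//.
  - by apply: eq_integral => y _; apply/esym/cvg_lim => //; exact: cvgf.
  - by move=> n; exact/measurable_EFinP/measurable_funP.
  - by move=> n y _; rewrite lee_fin.
  - by move=> y _ m n mn; rewrite lee_fin; exact/lefP/nd_nnsfun_approx.
transitivity (limn (fun n => \int[mu]_x ((f_ n x)%:E * (g x)%:E)))%E; last first.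
  rewrite -monotone_convergence//.
  - apply: eq_integral => y _; apply/cvg_lim => //.
    by apply: cvgeZr => //; exact: cvgf.
  - move=> n; apply: emeasurable_funM; exact/measurable_EFinP.
  - by move=> n y _; rewrite mule_ge0// lee_fin.
  - move=> y _ m n mn; rewrite lee_wpmul2r// lee_fin//.
    exact/lefP/nd_nnsfun_approx.
apply/congr_lim/funext => n.
rewrite integralT_nnsfun sintegralE.
under eq_integral => x _.
  rewrite fimfunE -fsumEFin// ge0_mule_fsuml; last first.
    by move=> r; rewrite nnfun_muleindic_ge0.
  over.
rewrite ge0_integral_fsum//; last 2 first.
- move=> r; apply: emeasurable_funM; last exact/measurable_EFinP.
  by apply/measurable_EFinP; exact: measurable_funM.
- by move=> r x _; rewrite mule_ge0// ?nnfun_muleindic_ge0// lee_fin.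
apply: eq_fsbigr => r _.
have [r0|r0] := ltP r 0.
  rewrite preimage_nnfun0// measure0 mule0.
  by under eq_integral do rewrite indic0 mulr0 mul0e; rewrite integral0.
under eq_integral do rewrite EFinM -muleA.
rewrite ge0_integralZl//=; last 2 first.
- by apply: emeasurable_funM; exact/measurable_EFinP.
- by move=> x _; rewrite mule_ge0// lee_fin.
rewrite nuE// [in LHS]integral_mkcond; congr (_ * _)%E.
apply: eq_integral => x _; rewrite patchE indicE.
by case: ifP => _; rewrite ?mul1e ?mul0e.
Qed.

End density.

Section affine.
Context (R : realType).
Notation mu := (@lebesgue_measure R).

Let F (h x : R) : measurableTypeR R -> measurableTypeR R := fun y => (y - x) / h.

Let mF h x : measurable_fun setT (F h x).
Proof.
have H : measurable_fun setT (fun y : R => (y - x) / h).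
  by apply: measurable_funM => //; exact: measurable_funB.
exact: H.
Qed.

(** The rescaled image of Lebesgue measure gives half-open intervals their length, and this
    characterizes Lebesgue measure. *)
Lemma lebesgue_measure_affine (h x : R) (A : set R) : 0 < h -> measurable A ->
  mu A = (h^-1%:E * mu ((fun y => (y - x) / h)%R @^-1` A))%E.
Proof.
move=> h0 mA.
pose m : {measure set (measurableTypeR R) -> \bar R} :=
  mscale (NngNum (ltW (divr_gt0 ltr01 h0)))
    (measure_function_pushforward__canonical__measure_function_Measure mu (mF h x)).
transitivity (m A); last by rewrite /m /= /mscale /= mul1r.
apply: lebesgue_measure_unique => // _ [[a b] _ <-]; rewrite /m /= /mscale/= mul1r.
rewrite /pushforward.
rewrite (_ : _ @^-1` _ = `](x + h * a), (x + h * b)]%classic); last first.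
  apply/seteqP; split=> y /=; rewrite !in_itv/= ltr_pdivlMr// ler_pdivrMr// ltrBrDl lerBlDl.
    by rewrite [a * h]mulrC [b * h]mulrC.
  by rewrite [a * h]mulrC [b * h]mulrC.
rewrite !lebesgue_measure_itv/= !lte_fin ltrD2l ltr_pM2l//.
case: ifP => _; last by rewrite mule0.
rewrite -!EFinB -EFinM; congr EFin; field.
by rewrite gt_eqF.
Qed.

Lemma ge0_integral_affine (h x : R) (f : R -> R) : 0 < h ->
  measurable_fun setT f -> (forall u, 0 <= f u) ->
  (\int[mu]_y (h^-1 * f ((y - x) / h))%:E = \int[mu]_u (f u)%:E)%E.
Proof.
move=> h0 mf f0.
under eq_integral do rewrite EFinM.
rewrite ge0_integralZl//=; last 3 first.
- apply/measurable_EFinP; apply: (measurableT_comp mf).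
  exact: (mF h x).
- by move=> y _; rewrite lee_fin.
- by rewrite lee_fin invr_ge0 ltW.
have hi0 : 0 <= h^-1 by rewrite invr_ge0 ltW.
have := @ge0_integral_pushforward _ _ _ _ _ _ (mF h x) mu setT (fun u => (f u)%:E) measurableT.
rewrite preimage_setT => /(_ _ _)/wrap[]//.
  exact/measurable_EFinP.
  by move=> u _; rewrite lee_fin.
rewrite [X in _ = X](_ : _ = \int[mu]_y (f ((y - x) / h))%:E)%E// => <-.
pose pm : {measure set (measurableTypeR R) -> \bar R} :=
  measure_function_pushforward__canonical__measure_function_Measure mu (mF h x).
transitivity (\int[mscale (NngNum hi0) pm]_u (f u)%:E)%E.
  rewrite ge0_integral_mscale//; first exact/measurable_EFinP.
  by move=> u _; rewrite lee_fin.
apply: eq_measure_integral => A mA _.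
exact/esym/(lebesgue_measure_affine x h0 mA).
Qed.

End affine.

(** * Kernel smoothing of the density *)

Section kernel_density.
Context (R : realType).
Notation mu := (@lebesgue_measure R).
Variables (K g : R -> R) (M Kb G L gmin : R).
Hypothesis K0 : forall u, 0 <= K u.
Hypothesis K_even : forall u, K (- u) = K u.
Hypothesis K_cont : continuous K.
Hypothesis K_supp : forall u, M < `|u| -> K u = 0.
Hypothesis K_bound : forall u, K u <= Kb.
Hypothesis K_int : (\int[mu]_x (K x)%:E = 1)%E.
Hypothesis g0 : forall x, 0 <= g x.
Hypothesis mg : measurable_fun setT g.
Hypothesis g_bound : forall x, g x <= G.
Hypothesis gmin0 : 0 <= gmin.
Hypothesis g_min : forall x, `|x| <= 1/2 -> gmin <= g x.
Hypothesis g_lip : forall x y, `|x| <= 1/2 -> `|y| <= 1/2 -> `|g x - g y| <= L * `|x - y|.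
Hypothesis L0 : 0 <= L.

Definition scaled_kernel (h x y : R) : R := h^-1 * K ((y - x) / h).
Local Notation V := scaled_kernel.

Let mK : measurable_fun setT K. Proof. exact: continuous_measurable_fun. Qed.

Lemma scaled_kernel_ge0 h x y : 0 < h -> 0 <= V h x y.
Proof. by move=> h0; rewrite mulr_ge0// invr_ge0 ltW. Qed.

Lemma scaled_kernel_le h x y : 0 < h -> V h x y <= h^-1 * Kb.
Proof. by move=> h0; rewrite ler_wpM2l// invr_ge0 ltW. Qed.

Lemma measurable_scaled_kernel h x : measurable_fun setT (V h x).
Proof.
apply: measurable_funM => //; apply: (measurableT_comp mK).
by apply: measurable_funM => //; exact: measurable_funB.
Qed.

Lemma integral_scaled_kernel h x (c : R) : 0 < h -> 0 <= c ->
  (\int[mu]_y (c * V h x y)%:E = c%:E)%E.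
Proof.
move=> h0 c0; under eq_integral do rewrite EFinM.
rewrite ge0_integralZl//=.
- by rewrite ge0_integral_affine// K_int mule1.
- by apply/measurable_EFinP; exact: measurable_scaled_kernel.
- by move=> y _; rewrite lee_fin scaled_kernel_ge0.
Qed.

Let mVg h x : measurable_fun setT (fun y => (V h x y * g y)%:E).
Proof.
by apply/measurable_EFinP; apply: measurable_funM => //; exact: measurable_scaled_kernel.
Qed.

Let Vg0 h x y : 0 < h -> 0 <= V h x y * g y.
Proof. by move=> h0; rewrite mulr_ge0// scaled_kernel_ge0. Qed.

Let mcV c h x : measurable_fun setT (fun y => (c * V h x y)%:E).
Proof.
by apply/measurable_EFinP; apply: measurable_funM => //; exact: measurable_scaled_kernel.
Qed.

Lemma kernel_mean_le h x : 0 < h -> (\int[mu]_y (V h x y * g y)%:E <= G%:E)%E.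
Proof.
move=> h0; rewrite -(@integral_scaled_kernel h x)//; last exact: le_trans (g_bound 0).
apply: ge0_le_integral => //.
- by move=> y _; rewrite lee_fin Vg0.
- exact: mVg.
- exact: mcV.
- by move=> y _; rewrite lee_fin [leRHS]mulrC ler_wpM2l// scaled_kernel_ge0.
Qed.

Lemma kernel_sqr_mean_le h x : 0 < h ->
  (\int[mu]_y (V h x y ^+ 2 * g y)%:E <= (h^-1 * Kb * G)%:E)%E.
Proof.
move=> h0; have hi0 : 0 <= h^-1 by rewrite invr_ge0 ltW.
have Kb0 : 0 <= Kb by apply: le_trans (K_bound 0).
have G0 : 0 <= G by apply: le_trans (g_bound 0).
rewrite -(@integral_scaled_kernel h x)//; last by rewrite !mulr_ge0.
apply: ge0_le_integral => //.
- by move=> y _; rewrite lee_fin mulr_ge0// sqr_ge0.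
- apply/measurable_EFinP; apply: measurable_funM => //.
  by apply: measurable_funX; exact: measurable_scaled_kernel.
- exact: mcV.
move=> y _; rewrite lee_fin expr2 -mulrA [leRHS]mulrC ler_wpM2l ?scaled_kernel_ge0//.
by rewrite ler_pM// ?scaled_kernel_le// scaled_kernel_ge0.
Qed.

(** [D] is a half-line of directions that carries half of the kernel mass. If it leads from x only
    to points of the support of g, the density is at least [gmin] wherever that half is placed. *)
Let half_mass (D : set R) : measurable D ->
  (\int[mu]_(u in D) (K u)%:E = (1/2)%:E)%E ->
  forall h x, 0 < h ->
  (forall y, D ((y - x) / h) -> `|(y - x) / h| <= M -> `|y| <= 1/2) ->
  ((gmin / 2)%:E <= \int[mu]_y (V h x y * g y)%:E)%E.
Proof.
move=> mD KD h x h0 Dh.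
have mKD : measurable_fun setT (K \_ D).
  by apply/(measurable_restrictT _ mD)/measurable_funTS.
have KD0 u : 0 <= (K \_ D) u by rewrite patchE; case: ifP.
have hi0 : 0 <= h^-1 by rewrite invr_ge0 ltW.
have <- : (\int[mu]_y (gmin%:E * (h^-1 * (K \_ D) ((y - x) / h))%:E) = (gmin / 2)%:E)%E.
  rewrite ge0_integralZl//=; last 2 first.
  - apply/measurable_EFinP; apply: measurable_funM => //.
    apply: (measurableT_comp mKD).
    by apply: measurable_funM => //; exact: measurable_funB.
  - by move=> y _; rewrite lee_fin mulr_ge0.
  rewrite ge0_integral_affine//.
  rewrite (_ : (\int[mu]_u _)%E = (1/2)%:E); first by rewrite -EFinM mul1r.
  by rewrite -KD [RHS]integral_mkcond restrict_EFin.
apply: ge0_le_integral => //.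
- by move=> y _; rewrite mule_ge0// lee_fin// mulr_ge0.
- apply: measurable_funeM; apply/measurable_EFinP; apply: measurable_funM => //.
  apply: (measurableT_comp mKD).
  by apply: measurable_funM => //; exact: measurable_funB.
- exact: mVg.
move=> y _; rewrite -EFinM lee_fin [leRHS]mulrC patchE.
case: ifPn => [/set_mem Dy|_]; last by rewrite !mulr0 mulr_ge0// scaled_kernel_ge0.
have [yM|yM] := leP `|(y - x) / h| M; last first.
  by rewrite K_supp// !mulr0 mulr_ge0// scaled_kernel_ge0.
by rewrite ler_wpM2r ?scaled_kernel_ge0// g_min// Dh.
Qed.

(** Of the two sides of x, the one facing the centre stays inside [-1/2, 1/2] over a distance 1/2,
    and by symmetry of the kernel it carries half of the mass. *)
Lemma kernel_mean_ge h x : 0 < h -> h * M <= 1/2 -> `|x| <= 1/2 ->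
  ((gmin / 2)%:E <= \int[mu]_y (V h x y * g y)%:E)%E.
Proof.
move=> h0 hM; rewrite ler_norml => /andP[x1 x2].
have Kpos : (\int[mu]_(u in [set u : R | (0 <= u)%R]) (K u)%:E = (1/2)%:E)%E.
  have := ge0_symfun_integralT K0 K_cont (fun u => esym (K_even u)).
  rewrite K_int => /esym.
  have : (0 <= \int[mu]_(u in [set u : R | (0 <= u)%R]) (K u)%:E)%E.
    by apply: integral_ge0 => u _; rewrite lee_fin.
  case: (\int[mu]_(u in _) _)%E => [r _ [H]|_|//]; first by congr EFin; lra.
  by rewrite gt0_muley// lte_fin.
have mpos : measurable [set u : R | (0 <= u)%R] by rewrite -set_itvcy.
have mneg : measurable [set u : R | (u <= 0)%R] by rewrite -set_itvNyc.
have Kneg : (\int[mu]_(u in [set u : R | (u <= 0)%R]) (K u)%:E = (1/2)%:E)%E.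
  rewrite -Kpos -set_itvNyc -set_itvcy.
  rewrite (ge0_integration_by_substitution0 (f := fun u => (K u)%:E)).
  - by apply: eq_integral => u _; rewrite K_even.
  - exact/measurable_EFinP.
  - by move=> u; rewrite lee_fin.
have aux y : `|(y - x) / h| <= M -> x - 1/2 <= y <= x + 1/2.
  rewrite normrM normfV (gtr0_norm h0) ler_pdivrMr// mulrC => H.
  have : `|y - x| <= 1/2 by exact: le_trans hM.
  by rewrite ler_norml => /andP[? ?]; apply/andP; split; lra.
have [x0|x0] := leP x 0.
  apply: (half_mass mpos Kpos) => // y /=; rewrite pmulr_lge0 ?invr_gt0// => y0 /aux.
  by rewrite ler_norml => /andP[? ?]; apply/andP; split; lra.
apply: (half_mass mneg Kneg) => // y /=; rewrite pmulr_lle0 ?invr_gt0// => y0 /aux.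
by rewrite ler_norml => /andP[? ?]; apply/andP; split; lra.
Qed.

(** The first term is the Lipschitz error at points whose kernel window stays in the support of g.
    The second is a crude bound in the boundary layers of width h M, where the window may cross the
    jump of g. *)
Definition bias_bound (h x : R) : R :=
  L * M * h + G * (1/2 - h * M < `|x|)%R%:R.

Let bias_pt h x y : 0 < h -> 0 <= M -> `|x| <= 1/2 ->
  `|V h x y * g y - g x * V h x y| <= bias_bound h x * V h x y.
Proof.
move=> h0 M0 xh; have V0 := scaled_kernel_ge0 x y h0.
rewrite [g x * _]mulrC -mulrBr normrM (ger0_norm V0) mulrC.
have [yM|yM] := leP `|(y - x) / h| M; last first.
  by rewrite /scaled_kernel K_supp// !mulr0.
rewrite ler_wpM2r// /bias_bound.
move: yM; rewrite normrM normfV (gtr0_norm h0) ler_pdivrMr// => yx.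
have [xin|xin] := ltP (1/2 - h * M) `|x|.
  rewrite mulr1; have : `|g y - g x| <= G.
    have := g_bound x; have := g_bound y; have := g0 x; have := g0 y.
    by rewrite ler_norml => *; apply/andP; split; lra.
  have : 0 <= L * M * h by rewrite !mulr_ge0// ltW.
  lra.
rewrite mulr0 addr0; have yh : `|y| <= 1/2.
  have : `|y| <= `|x| + `|y - x|.
    by rewrite -{1}[y](subrK x) addrC; exact: ler_normD.
  lra.
by apply: le_trans (g_lip yh xh) _; rewrite -mulrA ler_wpM2l.
Qed.

Lemma bias_bound_ge0 h x : 0 < h -> 0 <= M -> 0 <= bias_bound h x.
Proof.
move=> h0 M0; rewrite addr_ge0 ?mulr_ge0 ?(ltW h0)//.
exact: le_trans (g_bound 0).
Qed.

Lemma kernel_bias h x : 0 < h -> 0 <= M -> `|x| <= 1/2 ->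
  `|fine (\int[mu]_y (V h x y * g y)%:E)%E - g x| <= bias_bound h x.
Proof.
move=> h0 M0 xh.
have b0 := bias_bound_ge0 x h0 M0.
have mfin : (\int[mu]_y (V h x y * g y)%:E)%E \is a fin_num.
  rewrite ge0_fin_numE; first exact: le_lt_trans (kernel_mean_le x h0) (ltry _).
  by apply: integral_ge0 => y _; rewrite lee_fin Vg0.
rewrite ler_distl -!lee_fin fineK//; apply/andP; split.
  rewrite EFinB leeBlDr// -[leLHS](@integral_scaled_kernel h x)//.
  rewrite -[X in (_ + X)%E](@integral_scaled_kernel h x)// -ge0_integralD//=.
  - apply: ge0_le_integral => //=.
    + by move=> y _; rewrite lee_fin mulr_ge0// scaled_kernel_ge0.
    + exact: mcV.
    + by apply: emeasurable_funD; [exact: mVg|exact: mcV].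
    move=> y _; rewrite -EFinD lee_fin; have := bias_pt y h0 M0 xh.
    by rewrite ler_norml => /andP[? ?]; lra.
  - by move=> y _; rewrite lee_fin Vg0.
  - exact: mVg.
  - by move=> y _; rewrite lee_fin mulr_ge0// scaled_kernel_ge0.
  - exact: mcV.
rewrite -(@integral_scaled_kernel h x)//; last by rewrite addr_ge0.
apply: ge0_le_integral => //=.
- by move=> y _; rewrite lee_fin Vg0.
- exact: mVg.
- exact: mcV.
move=> y _; rewrite lee_fin; have := bias_pt y h0 M0 xh.
by rewrite ler_norml => /andP[? ?]; lra.
Qed.

Lemma measurable_bias_bound h : measurable_fun setT (bias_bound h).
Proof.
apply: measurable_funD => //; apply: measurable_funM => //.
apply: (@measurableT_comp _ _ _ _ _ _ (fun b : bool => b%:R : R)) => //.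
by apply: measurable_fun_ltr => //; exact: normr_measurable.
Qed.

(** The two boundary layers have length at most h M each, so the jumps of g contribute O(h) after
    integration although the bias there is not small. *)
Lemma integral_bias_bound h : 0 < h -> 0 <= M ->
  (\int[mu]_(x in `[(- (1/2))%R, (1/2)%R]) (bias_bound h x)%:E
    <= ((L * M + 2 * G * M) * h)%:E)%E.
Proof.
move=> h0 M0; have G0 : 0 <= G by apply: le_trans (g_bound 0).
have hM0 : 0 <= h * M by rewrite mulr_ge0// ltW.
pose D1 : set R := `[(- (1/2)), (- (1/2) + h * M)]%classic.
pose D2 : set R := `[(1/2 - h * M), (1/2)]%classic.
have mD1 : measurable D1 by exact: measurable_itv.
have mD2 : measurable D2 by exact: measurable_itv.
have mI (D : set R) : measurable D ->
    measurable_fun (`[(- (1/2))%R, (1/2)%R]%classic : set R) (fun x : R => (\1_D x : R)%:E : \bar R).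
  move=> mD; apply/measurable_EFinP/measurable_funTS; exact: measurable_indic.
have mI12 : measurable_fun (`[(- (1/2))%R, (1/2)%R]%classic : set R)
    (fun x : R => ((\1_D1 x : R)%:E + (\1_D2 x : R)%:E)%E).
  by apply: emeasurable_funD; exact: mI.
apply: (@le_trans _ _ (\int[mu]_(x in `[(- (1/2))%R, (1/2)%R])
    (cst (L * M * h)%:E x + (G%:E * ((\1_D1 x : R)%:E + (\1_D2 x : R)%:E))))%E).
  apply: ge0_le_integral => //=.
  - by move=> x _; rewrite lee_fin bias_bound_ge0.
  - by apply/measurable_EFinP/measurable_funTS; exact: measurable_bias_bound.
  - apply: emeasurable_funD => //; exact: measurable_funeM.
  move=> x; rewrite in_itv/= => /andP[x1 x2].
  rewrite -[((\1_D1 x)%:E + _)%E]EFinD -EFinM -EFinD lee_fin /bias_bound.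
  rewrite lerD2l ler_wpM2l//.
  rewrite !indicE; case: ltP => [H|_]; last by rewrite addr_ge0.
  have [x0|x0] := leP 0 x.
    rewrite (mem_set (_ : D2 x)) ?lerDr//; rewrite /D2/= in_itv/=.
    by rewrite ger0_norm// in H; apply/andP; split; lra.
  rewrite (mem_set (_ : D1 x)) ?lerDl//; rewrite /D1/= in_itv/=.
  by rewrite ltr0_norm// in H; apply/andP; split; lra.
have muI : mu `[(- (1/2)), (1/2)]%classic = 1%E.
  by rewrite lebesgue_measure_itv/= lte_fin ifT; [rewrite -EFinB; congr EFin; lra|lra].
have muD (D : set R) : measurable D -> (mu D <= (h * M)%:E)%E ->
    (\int[mu]_(x in `[(- (1/2))%R, (1/2)%R]) (\1_D x : R)%:E <= (h * M)%:E)%E.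
  move=> mD; apply: le_trans; rewrite integral_indic//.
  by apply: le_measure; rewrite ?inE//; exact: measurableI.
have H1 : (mu D1 <= (h * M)%:E)%E.
  rewrite lebesgue_measure_itv/= lte_fin; case: ifP => _; rewrite ?lee_fin//.
  by lra.
have H2 : (mu D2 <= (h * M)%:E)%E.
  rewrite lebesgue_measure_itv/= lte_fin; case: ifP => _; rewrite ?lee_fin//.
  by lra.
rewrite ge0_integralD//=; last 3 first.
- by move=> x _; rewrite lee_fin !mulr_ge0// ltW.
- by move=> x _; rewrite mule_ge0// adde_ge0// lee_fin.
- exact: measurable_funeM.
rewrite integral_cst//= [X in (_ * X + _)%E](_ : _ = 1%E); last exact: muI.
rewrite mule1 ge0_integralZl//=; last by move=> x _; rewrite adde_ge0// lee_fin.
have intD : (\int[mu]_(x in `[(- (1/2))%R, (1/2)%R]) ((\1_D1 x : R)%:E + (\1_D2 x : R)%:E) =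
    \int[mu]_(x in `[(- (1/2))%R, (1/2)%R]) (\1_D1 x : R)%:E +
    \int[mu]_(x in `[(- (1/2))%R, (1/2)%R]) (\1_D2 x : R)%:E)%E.
  apply: ge0_integralD => //; first [exact: mI|by move=> x _; rewrite lee_fin].
rewrite intD.
apply: (@le_trans _ _ ((L * M * h)%:E + G%:E * ((h * M)%:E + (h * M)%:E))%E).
  by rewrite leeD2l// lee_wpmul2l ?lee_fin// leeD// muD.
rewrite [leLHS](_ : _ = (L * M * h + G * (h * M + h * M))%:E)// lee_fin; lra.
Qed.

End kernel_density.

(** * The sampling scheme *)

Section joint_measurability.
Context d (T : measurableType d) (R : realType).
Variables (X eps Y : nat -> T -> R) (f K : R -> R) (theta alpha f1 th1 : R).
Hypothesis mf : measurable_fun setT f.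
Hypothesis mK : measurable_fun setT K.
Hypothesis K0 : forall u, 0 <= K u.
Hypothesis YE : forall n w, Y n w = f (X n w - theta) + eps n w.
Context dE (E : measurableType dE) (W : E -> T).

Lemma bandwidth_ge0 n : 0 <= bandwidth alpha n :> R.
Proof. exact: powR_ge0. Qed.

Lemma ghat_ge0 n w x : 0 <= ghat K alpha X n w x.
Proof.
rewrite mulr_ge0 ?invr_ge0// sumr_ge0// => i _.
by rewrite mulr_ge0// invr_ge0 bandwidth_ge0.
Qed.

(** Composition with [W] lets one proof serve for T itself, for T with the sigma-algebra of a past,
    and for products; only the finitely many variables that enter have to be measurable. *)
Lemma measurable_ghat (u : E -> R) n :
  (forall i, (1 <= i <= n)%N -> measurable_fun setT (X i \o W)) ->
  measurable_fun setT u ->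
  measurable_fun setT (fun e => ghat K alpha X n (W e) (u e)).
Proof.
move=> mX mu; apply: measurable_funM => //.
suff H m : (m <= n)%N -> measurable_fun setT (fun e => \sum_(1 <= i < m.+1)
    ((bandwidth alpha i)^-1 * K ((X i (W e) - u e) / bandwidth alpha i))).
  exact: H.
elim: m => [_|m IH mn].
  by under eq_fun do rewrite big_geq//; exact: measurable_cst.
under eq_fun do rewrite big_nat_recr//=.
apply: measurable_funD; first exact: IH (ltnW mn).
apply: measurable_funM => //; apply: (measurableT_comp mK).
by apply: measurable_funM => //; apply: measurable_funB => //; exact: mX.
Qed.

(** On nonnegative reals, 0 included, the inverse agrees with the measurable power of exponent
    -1. *)
Lemma measurable_inv_ge0 (u : E -> R) : measurable_fun setT u -> (forall e, 0 <= u e) ->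
  measurable_fun setT (fun e => (u e)^-1).
Proof.
move=> mu u0; under eq_fun do rewrite -powR_inv1//.
exact: (measurableT_comp (measurable_powR _)).
Qed.

Lemma projCE (x : R) : projC x = Num.max (- (1/4)) (Num.min (1/4) x).
Proof.
rewrite /projC; case: (leP (1/4) x) => h1.
  by rewrite max_r//; lra.
by case: (leP x _).
Qed.

Lemma measurable_sin_shift (u v : E -> R) : measurable_fun setT u -> measurable_fun setT v ->
  measurable_fun setT (fun e => sin (2 * pi * (u e - v e))).
Proof.
move=> mu mv; apply: (measurableT_comp (continuous_measurable_fun (@continuous_sin R))).
by apply: measurable_funM => //; exact: measurable_funB.
Qed.

Lemma measurable_theta_hat n :
  (forall i, (i <= n)%N -> measurable_fun setT (X i \o W)) ->
  (forall i, (i <= n)%N -> measurable_fun setT (eps i \o W)) ->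
  measurable_fun setT (fun e => theta_hat K alpha f1 th1 X Y n (W e)).
Proof.
elim: n => [|n IH] mX me; first exact: measurable_cst.
case: n IH mX me => [|n] IH mX me; first exact: measurable_cst.
have mth := IH (fun i ni => mX i (leqW ni)) (fun i ni => me i (leqW ni)).
rewrite [X in measurable_fun _ X](_ : _ = fun e => projC (pre_step K alpha f1 X Y n.+1
  (theta_hat K alpha f1 th1 X Y n.+1 (W e)) (W e)))//.
under eq_fun do rewrite projCE.
apply: measurable_maxr => //; apply: measurable_minr => //.
rewrite /pre_step; apply: measurable_funD => //; apply: measurable_funM => //.
rewrite /That; apply: measurable_funM; last first.
  under eq_fun do rewrite YE.
  apply: measurable_funD; last exact: me.
  by apply: (measurableT_comp mf); apply: measurable_funB => //; exact: mX.
apply: measurable_funM.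
  by apply: measurable_sin_shift => //; exact: mX.
apply: measurable_inv_ge0; last by move=> e; exact: ghat_ge0.
apply: measurable_ghat; last exact: mX.
by move=> i /andP[_ ni]; apply: mX; exact: leqW.
Qed.

End joint_measurability.

Section bounded.
Context d (T : measurableType d) (R : realType) (P : probability T R).

Lemma bounded_integrable (u : T -> R) (C : R) : measurable_fun setT u ->
  (forall w, `|u w| <= C) -> P.-integrable setT (EFin \o u).
Proof.
move=> mu uC; apply: measurable_bounded_integrable => //.
  by rewrite -ge0_fin_numE// fin_num_measure.
exists C; split; first by rewrite num_real.
by move=> x Cx w _; apply: le_trans (uC w) (ltW Cx).
Qed.

Lemma integral_cst1 (c : R) : (\int[P]_w c%:E = c%:E)%E.
Proof. rewrite integral_cst//= [X in (_ * X)%E](_ : _ = 1%E) ?mule1//.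
exact: probability_setT. Qed.

End bounded.

(* X_n is revealed at time 2n and eps_n at time 2n+1. *)
Definition noise_key (bn : bool * nat) : nat := bn.2.*2 + ~~ bn.1.

Section sampling.
Context d (T : measurableType d) (R : realType) (P : probability T R).
Variables (X eps : nat -> {RV P >-> R}) (g : R -> R).
Definition sample (bn : bool * nat) : {RV P >-> R} :=
  if bn.1 then X bn.2 else eps bn.2.
Hypothesis indep : mutually_independent P (fun bn => sample bn : T -> R).
Hypothesis X_law : forall n (A : set R), measurable A ->
  P (X n @^-1` A) = (\int[lebesgue_measure]_(x in A) (g x)%:E)%E.
Hypothesis mg : measurable_fun setT g.
Hypothesis g0 : forall x, 0 <= g x.

(** Time 2n gives access to X_i and eps_i for i < n and is the right past for X_n; time 2n+1 adds
    X_n itself and is the right past for eps_n. *)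
Definition before (m : nat) : pred (bool * nat) := fun bn => (noise_key bn < m)%N.
Definition hist (m : nat) := past sample (before m).
Definition hist_id (m : nat) : {RV P >-> hist m} := past_id sample (before m).

Lemma hist_X m i : (i.*2 < m)%N -> measurable_fun setT (X i : hist m -> R).
Proof.
move=> im; apply: (@past_measurable _ _ _ P _ sample (before m) (true, i)).
by rewrite /before /noise_key /= addn0.
Qed.

Lemma hist_eps m i : (i.*2.+1 < m)%N -> measurable_fun setT (eps i : hist m -> R).
Proof.
move=> im; apply: (@past_measurable _ _ _ P _ sample (before m) (false, i)).
by rewrite /before /noise_key /= addn1.
Qed.

Lemma hist_indep_X n : forall (A : set (hist n.*2)) (B : set R),
  measurable A -> measurable B ->
  P (hist_id n.*2 @^-1` A `&` X n @^-1` B) =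
    (P (hist_id n.*2 @^-1` A) * P (X n @^-1` B))%E.
Proof.
apply: (@past_indep _ _ _ P _ sample indep (before n.*2) (true, n)).
by rewrite /before /noise_key /= addn0 ltnn.
Qed.

Lemma hist_indep_eps n : forall (A : set (hist n.*2.+1)) (B : set R),
  measurable A -> measurable B ->
  P (hist_id n.*2.+1 @^-1` A `&` eps n @^-1` B) =
    (P (hist_id n.*2.+1 @^-1` A) * P (eps n @^-1` B))%E.
Proof.
apply: (@past_indep _ _ _ P _ sample indep (before n.*2.+1) (false, n)).
by rewrite /before /noise_key /= addn1 ltnn.
Qed.

Lemma ge0_integral_X n (phi : R -> \bar R) : measurable_fun setT phi ->
  (forall x, 0 <= phi x)%E ->
  (\int[P]_w phi (X n w) = \int[lebesgue_measure]_x (phi x * (g x)%:E))%E.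
Proof.
move=> mphi phi0.
have mX : @measurable_fun _ _ T (measurableTypeR R) setT (X n).
  exact: (measurable_funP (X n)).
pose X' : {RV P >-> measurableTypeR R} := HB.pack (X n : T -> measurableTypeR R)
  (isMeasurableFun.Build _ _ T (measurableTypeR R) _ mX).
transitivity (\int[P]_w phi (X' w))%E => //.
rewrite -(ge0_integral_distribution X')//.
by apply: ge0_integral_density => // A mA; exact: X_law.
Qed.

Lemma integral_X n (phi : R -> R) : measurable_fun setT phi ->
  (\int[P]_w (phi (X n w))%:E = \int[lebesgue_measure]_x (phi x * g x)%:E)%E.
Proof.
move=> mphi; have mphiE : measurable_fun setT (EFin \o phi) by exact/measurable_EFinP.
rewrite integralE [RHS]integralE.
rewrite (funepos_comp (EFin \o phi) (X n)) (funeneg_comp (EFin \o phi) (X n)).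
rewrite [X in (X - _)%E](ge0_integral_X n (measurable_funepos mphiE))//.
rewrite [X in (_ - X)%E](ge0_integral_X n (measurable_funeneg mphiE))//.
congr (_ - _)%E; apply: eq_integral => x _.
- by rewrite !unlock /= EFinM maxe_pMl ?lee_fin// mul0e.
- by rewrite !unlock /= maxe_pMl ?lee_fin// mul0e -EFinM mulNr.
Qed.

Lemma freezing_X n (psi : hist n.*2 * R -> \bar R) :
  measurable_fun setT psi -> (forall z, 0 <= psi z)%E ->
  (\int[P]_w psi (w : hist n.*2, X n w)
    = \int[P]_w \int[P]_w' psi (w : hist n.*2, X n w'))%E.
Proof. by move=> mpsi psi0; rewrite (ge0_freezing (hist_indep_X (n := n))). Qed.

(** After the exchange the past is averaged at a fixed point x, so that estimates of [ghat] at a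
    deterministic point can be integrated against g. *)
Lemma swap_X n (psi : hist n.*2 * R -> \bar R) :
  measurable_fun setT psi -> (forall z, 0 <= psi z)%E ->
  (\int[P]_w \int[P]_w' psi (w : hist n.*2, X n w')
    = \int[lebesgue_measure]_x (\int[P]_w psi (w : hist n.*2, x) * (g x)%:E))%E.
Proof.
move=> mpsi psi0.
have mpsi' : measurable_fun setT (fun z : T * R => psi (hist_id n.*2 z.1, z.2)).
  apply: (measurableT_comp mpsi); apply: measurable_fun_pair => //.
  by apply: measurableT_comp => //.
transitivity (\int[P]_w \int[P]_w' psi (hist_id n.*2 w, X n w'))%E => //.
rewrite (fubini_tonelli (m1 := P) (m2 := P)
  (fun z : T * T => psi (hist_id n.*2 z.1, X n z.2)))/=; last 2 first.
- apply: (measurableT_comp mpsi); apply: measurable_fun_pair.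
    by apply: measurableT_comp => //.
  by apply: measurableT_comp => //.
- by move=> z; exact: psi0.
rewrite (@ge0_integral_X n (fun x => \int[P]_w psi (hist_id n.*2 w, x))%E)//.
- exact: (measurable_fun_fubini_tonelli_G (m1 := P)
    (fun z : T * R => psi (hist_id n.*2 z.1, z.2))).
- by move=> x; apply: integral_ge0 => w _; exact: psi0.
Qed.

End sampling.

(** * Mean error and lower tail of the density estimate *)

Section density_estimate.
Context d (T : measurableType d) (R : realType) (P : probability T R).
Variables (X eps : nat -> {RV P >-> R}) (K g : R -> R) (alpha M Kb G L gmin : R).
Hypothesis indep : mutually_independent P (fun bn => sample X eps bn : T -> R).
Hypothesis X_law : forall n (A : set R), measurable A ->
  P (X n @^-1` A) = (\int[lebesgue_measure]_(x in A) (g x)%:E)%E.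
Hypothesis K0 : forall u, 0 <= K u.
Hypothesis K_even : forall u, K (- u) = K u.
Hypothesis K_cont : continuous K.
Hypothesis M0 : 0 <= M.
Hypothesis K_supp : forall u, M < `|u| -> K u = 0.
Hypothesis K_bound : forall u, K u <= Kb.
Hypothesis K_int : (\int[lebesgue_measure]_x (K x)%:E = 1)%E.
Hypothesis g0 : forall x, 0 <= g x.
Hypothesis mg : measurable_fun setT g.
Hypothesis g_supp : forall x, 1/2 < `|x| -> g x = 0.
Hypothesis g_bound : forall x, g x <= G.
Hypothesis gmin0 : 0 < gmin.
Hypothesis g_min : forall x, `|x| <= 1/2 -> gmin <= g x.
Hypothesis g_lip : forall x y, `|x| <= 1/2 -> `|y| <= 1/2 -> `|g x - g y| <= L * `|x - y|.
Hypothesis L0 : 0 <= L.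
Hypothesis alpha01 : 0 < alpha < 1.

Notation mu := (@lebesgue_measure R).
Notation hist := (hist X eps).
Notation hist_id := (hist_id X eps).
Let h (k : nat) : R := bandwidth alpha k.+1.
Let v (x : R) (k : nat) (w : T) : R := scaled_kernel K (h k) x (X k.+1 w).
Let m (x : R) (k : nat) : R := fine (\int[mu]_y (scaled_kernel K (h k) x y * g y)%:E)%E.

Let mK : measurable_fun setT K. Proof. exact: continuous_measurable_fun. Qed.
Let G0 : 0 <= G. Proof. exact: le_trans (g_bound 0). Qed.
Let Kb0 : 0 <= Kb. Proof. exact: le_trans (K_bound 0). Qed.

Let h_gt0 k : 0 < h k.
Proof. by rewrite powR_gt0// ltr0n. Qed.

Let hV k : (h k)^-1 = k.+1%:R `^ alpha.
Proof. by rewrite /h /bandwidth powRN invrK. Qed.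

Let hV_le k n : (k < n)%N -> (h k)^-1 <= n%:R `^ alpha.
Proof.
move=> kn; rewrite hV ge0_ler_powR// ?nnegrE// ?ler_nat//.
by case/andP: alpha01 => /ltW.
Qed.

Let hV_ge1 k : 1 <= (h k)^-1.
Proof.
rewrite hV -[leLHS](powRr0 k.+1%:R) ler_powR ?ler1n//.
by case/andP: alpha01 => /ltW.
Qed.

Let v0 x k w : 0 <= v x k w. Proof. exact: scaled_kernel_ge0. Qed.

Let mfin x k : (\int[mu]_y (scaled_kernel K (h k) x y * g y)%:E)%E = (m x k)%:E.
Proof.
rewrite /m fineK// ge0_fin_numE.
  by apply: (le_lt_trans _ (ltry G)); exact: kernel_mean_le.
by apply: integral_ge0 => y _; rewrite lee_fin mulr_ge0// scaled_kernel_ge0.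
Qed.

Let m_ge0 x k : 0 <= m x k.
Proof.
rewrite fine_ge0//; apply: integral_ge0 => y _.
by rewrite lee_fin mulr_ge0// scaled_kernel_ge0.
Qed.

Let m_le x k : m x k <= G.
Proof. by rewrite -lee_fin -mfin; apply: kernel_mean_le. Qed.

Let mV x k : measurable_fun setT (scaled_kernel K (h k) x).
Proof. exact: measurable_scaled_kernel. Qed.

Let mv x k : measurable_fun setT (v x k).
Proof. exact: measurableT_comp. Qed.

Let v_le x k w : v x k w <= (h k)^-1 * Kb.
Proof. exact: scaled_kernel_le. Qed.

Let Ev x k : (\int[P]_w (v x k w)%:E = (m x k)%:E)%E.
Proof.
rewrite -mfin /v (ge0_integral_X X_law mg g0 k.+1 (phi := fun y => (scaled_kernel K (h k) x y)%:E)).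
- by apply: eq_integral => y _; rewrite EFinM.
- exact/measurable_EFinP.
- by move=> y; rewrite lee_fin scaled_kernel_ge0.
Qed.

Let Ev2 x k : (\int[P]_w (v x k w ^+ 2)%:E <= ((h k)^-1 * Kb * G)%:E)%E.
Proof.
rewrite /v (ge0_integral_X X_law mg g0 k.+1 (phi := fun y => (scaled_kernel K (h k) x y ^+ 2)%:E)).
- under eq_integral do rewrite -EFinM.
  exact: kernel_sqr_mean_le.
- by apply/measurable_EFinP; exact: measurable_funX.
- by move=> y; rewrite lee_fin sqr_ge0.
Qed.

Let hist_v x j n : (j < n)%N -> measurable_fun setT (v x j : hist n.+1.*2 -> R).
Proof.
move=> jn; apply: (measurableT_comp (mV x j)); apply: hist_X.
by rewrite ltn_double ltnS.
Qed.

Let v_norm x k w : `|v x k w - m x k| <= (h k)^-1 * Kb + G.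
Proof.
have := v_le x k w; have := v0 x k w; have := m_le x k; have := m_ge0 x k.
have : 0 <= (h k)^-1 * Kb by rewrite mulr_ge0// invr_ge0 ltW.
by rewrite ler_norml => *; apply/andP; split; lra.
Qed.

Let centered_orth x j k : (j < k)%N ->
  \int[P]_w ((v x j w - m x j) * (v x k w - m x k)) = 0.
Proof.
move=> jk.
pose psi (z : hist k.+1.*2 * R) :=
  (v x j z.1 - m x j) * (scaled_kernel K (h k) x z.2 - m x k).
have mc i : measurable_fun setT (fun w => v x i w - m x i) by exact: measurable_funB.
apply: (freezing_centered (hist_indep_X indep (n := k.+1)) (psi := psi)).
- apply: measurable_funM; apply: measurable_funB => //.
    by apply: (measurableT_comp (hist_v x jk)).
  exact: (measurableT_comp (mV x k)).
- apply: (@bounded_integrable _ _ _ _ _ (((h j)^-1 * Kb + G) * ((h k)^-1 * Kb + G))).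
    exact: (measurable_funM (mc j) (mc k)).
  by move=> w; rewrite normrM ler_pM// v_norm.
- move=> e; apply: (@bounded_integrable _ _ _ _ _ (((h j)^-1 * Kb + G) * ((h k)^-1 * Kb + G))).
    exact: (measurable_funM (measurable_cst (v x j e - m x j)) (mc k)).
  by move=> w; rewrite normrM ler_pM// v_norm.
- move=> e; have ic : P.-integrable setT (EFin \o (fun w => v x k w - m x k)).
    by apply: bounded_integrable => // w; exact: v_norm.
  have iv : P.-integrable setT (EFin \o v x k).
    apply: (@bounded_integrable _ _ _ _ _ ((h k)^-1 * Kb)) => // w.
    by rewrite ger0_norm.
  rewrite /psi /= RintegralZl// RintegralB//; last first.
    by apply: (@bounded_integrable _ _ _ _ _ `|m x k|).
  rewrite /Rintegral Ev integral_cst1 /= subrr mulr0//.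
Qed.

(** From (v - m)^2 <= 2 v^2 + 2 m^2: the mean of v^2 is at most Kb G / h, and m^2 <= G^2 is absorbed
    because 1/h >= 1. *)
Let Cv : R := 2 * Kb * G + 2 * G ^+ 2.

Let Cv0 : 0 <= Cv.
Proof. by rewrite addr_ge0 ?mulr_ge0 ?sqr_ge0. Qed.

Let centered_sqr x k : (\int[P]_w ((v x k w - m x k) ^+ 2)%:E <= (Cv * (h k)^-1)%:E)%E.
Proof.
apply: (@le_trans _ _ (\int[P]_w (2%:E * (v x k w ^+ 2)%:E + (2 * G ^+ 2)%:E))%E).
  apply: ge0_le_integral => //=.
  - by move=> w _; rewrite lee_fin sqr_ge0.
  - by apply/measurable_EFinP; apply: measurable_funX; exact: measurable_funB.
  - apply: emeasurable_funD => //; apply: measurable_funeM.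
    by apply/measurable_EFinP; exact: measurable_funX.
  move=> w _; rewrite -EFinM -EFinD lee_fin.
  have := m_le x k; have := m_ge0 x k; have := v0 x k w.
  by move: (v x k w) (m x k) => a b; nra.
rewrite ge0_integralD//=; last 3 first.
- by move=> w _; rewrite mule_ge0// lee_fin sqr_ge0.
- by apply: measurable_funeM; apply/measurable_EFinP; exact: measurable_funX.
- by move=> w _; rewrite lee_fin mulr_ge0 ?sqr_ge0.
rewrite integral_cst1 ge0_integralZl//=; last 2 first.
- by apply/measurable_EFinP; exact: measurable_funX.
- by move=> w _; rewrite lee_fin sqr_ge0.
apply: (@le_trans _ _ (2%:E * ((h k)^-1 * Kb * G)%:E + (2 * G ^+ 2)%:E)%E).
  by rewrite leeD2r// lee_wpmul2l.
rewrite [leLHS](_ : _ = (2 * ((h k)^-1 * Kb * G) + 2 * G ^+ 2)%:E)//.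
rewrite lee_fin [leRHS]mulrDl; apply: lerD.
  by rewrite -!mulrA [(h k)^-1 * _]mulrC !mulrA.
by rewrite ler_peMr// mulr_ge0// sqr_ge0.
Qed.

Let variance_sum x n :
  (\int[P]_w ((\sum_(0 <= k < n) (v x k w - m x k)) ^+ 2)%:E
    <= (n%:R * (Cv * n%:R `^ alpha))%:E)%E.
Proof.
rewrite (orthogonal_sum_sqr (Z := fun k w => v x k w - m x k)) ?iota_uniq//.
- apply: (@le_trans _ _ (\sum_(0 <= k < n) (Cv * n%:R `^ alpha)%:E)%E).
    rewrite big_seq [leRHS]big_seq; apply: lee_sum => k.
    rewrite mem_index_iota => /andP[_ kn]; apply: (le_trans (centered_sqr x k)).
    by rewrite lee_fin ler_wpM2l// hV_le.
  by rewrite sumEFin lee_fin sumr_const_nat subn0 mulr_natl.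
- by move=> k; exact: measurable_funB.
- by move=> k; apply: le_lt_trans (centered_sqr x k) (ltry _).
- by move=> j k; exact: centered_orth.
Qed.

Let ghatE n w x : ghat K alpha (fun n => X n : T -> R) n w x
  = n%:R^-1 * \sum_(0 <= k < n) v x k w.
Proof. by rewrite /ghat big_add1. Qed.

(** The variance of the estimate at a point is at most Cv n^(alpha - 1), so beta is the exponent of
    its standard deviation. *)
Let beta : R := (1 - alpha) / 2.

Let bias_avg n x : R := n%:R^-1 * \sum_(0 <= k < n) bias_bound M G L (h k) x.

Let ghat_L1 n x : (0 < n)%N -> `|x| <= 1/2 ->
  (\int[P]_w `|ghat K alpha (fun n => X n : T -> R) n w x - g x|%:E
    <= ((Cv + 1) * n%:R `^ (- beta) + bias_avg n x)%:E)%E.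
Proof.
move=> n0 xh; have nn0 : 0 < n%:R :> R by rewrite ltr0n.
pose S w : R := \sum_(0 <= k < n) (v x k w - m x k).
have mS : measurable_fun setT S.
  by apply: measurable_sum => k; exact: measurable_funB.
(* The bound |a| <= s a^2 + 1/s replaces a square root of the variance; this s gives both terms the
   order n^(-beta). *)
pose s : R := n%:R `^ beta.
have s0 : 0 < s by rewrite powR_gt0.
pose b := s^-1 + bias_avg n x.
have bias0 : 0 <= bias_avg n x.
  rewrite mulr_ge0 ?invr_ge0 ?(ltW nn0)// sumr_ge0// => k _.
  exact: (bias_bound_ge0 g0 g_bound L0).
have b0 : 0 <= b by rewrite addr_ge0// invr_ge0 ltW.
apply: (@le_trans _ _ (\int[P]_w ((s * n%:R ^- 2)%:E * (S w ^+ 2)%:E + b%:E))%E).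
  apply: ge0_le_integral => //=.
  - apply/measurable_EFinP; apply: measurableT_comp => //.
    apply: measurable_funB => //; under eq_fun do rewrite ghatE.
    by apply: measurable_funM => //; exact: measurable_sum.
  - apply: emeasurable_funD => //; apply: measurable_funeM.
    by apply/measurable_EFinP; exact: measurable_funX.
  move=> w _; rewrite -EFinM -EFinD lee_fin ghatE.
  have -> : n%:R^-1 * \sum_(0 <= k < n) v x k w - g x
      = n%:R^-1 * S w + n%:R^-1 * \sum_(0 <= k < n) (m x k - g x).
    rewrite -mulrDr /S -big_split/=.
    under [in RHS]eq_bigr do rewrite addrA subrK.
    rewrite sumrB mulrBr; congr (_ - _).
    by rewrite sumr_const_nat subn0 -[g x *+ n]mulr_natl mulKf// gt_eqF.
  apply: le_trans (ler_normD _ _) _; rewrite /b addrA; apply: lerD.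
    have -> : s * n%:R ^- 2 * S w ^+ 2 = s * (`|n%:R^-1 * S w|) ^+ 2.
      by rewrite real_normK ?num_real// exprMn exprVn [RHS]mulrA.
    have := normr_ge0 (n%:R^-1 * S w); set a := `|_| => a0.
    have st : s * s^-1 = 1 by rewrite mulfV// gt_eqF.
    have t0 : 0 < s^-1 by rewrite invr_gt0.
    move: (s^-1) st t0 => t st t0.
    by have := sqr_ge0 (s * a - 1); nra.
  rewrite normrM ger0_norm ?invr_ge0 ?(ltW nn0)// ler_wpM2l ?invr_ge0 ?(ltW nn0)//.
  apply: le_trans (ler_norm_sum _ _ _) _; apply: ler_sum => k _.
  by apply: kernel_bias => //; exact: ltW.
rewrite ge0_integralD//=; last 2 first.
- by move=> w _; rewrite mule_ge0// lee_fin ?sqr_ge0// mulr_ge0 ?invr_ge0 ?exprn_ge0 ?ltW.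
- by apply: measurable_funeM; apply/measurable_EFinP; exact: measurable_funX.
rewrite integral_cst1 ge0_integralZl//=; last 3 first.
- by apply/measurable_EFinP; exact: measurable_funX.
- by move=> w _; rewrite lee_fin sqr_ge0.
- by rewrite lee_fin mulr_ge0 ?invr_ge0 ?exprn_ge0 ?ltW.
apply: (@le_trans _ _ ((s * n%:R ^- 2)%:E * (n%:R * (Cv * n%:R `^ alpha))%:E + b%:E)%E).
  rewrite leeD2r// lee_wpmul2l ?variance_sum// lee_fin.
  by rewrite mulr_ge0 ?invr_ge0 ?exprn_ge0 ?ltW.
rewrite [leLHS](_ : _ = (s * n%:R ^- 2 * (n%:R * (Cv * n%:R `^ alpha)) + b)%:E)//.
rewrite lee_fin /b addrA lerD2r powRN -/s [leRHS]mulrDl mul1r lerD2r.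
rewrite le_eqVlt; apply/orP; left; apply/eqP.
have -> : s^-1 = s * (n%:R^-1 * n%:R `^ alpha).
  rewrite /s -powRN -powR_inv1 ?ler0n// -!powRD ?pnatr_eq0 ?(gtn_eqF n0) ?implybT//.
  by congr (_ `^ _); rewrite /beta; lra.
rewrite -exprVn expr2.
have nV : n%:R^-1 * n%:R = 1 :> R by rewrite mulVf// gt_eqF.
transitivity (s * n%:R^-1 * Cv * n%:R `^ alpha * (n%:R^-1 * n%:R)).
  by ring.
by rewrite nV; ring.
Qed.

Let ghat_meas n : measurable_fun setT
  (fun z : hist n.+1.*2 * R => ghat K alpha (fun n => X n : T -> R) n z.1 z.2).
Proof.
apply: (@measurable_ghat _ T R (fun n => X n : T -> R) K alpha mK _ _
  (fun z : hist n.+1.*2 * R => z.1 : T) snd n) => //.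
move=> i /andP[_ ni].
have mXi : measurable_fun setT (X i : hist n.+1.*2 -> R).
  by apply: hist_X; rewrite ltn_double ltnS.
exact: (measurableT_comp mXi measurable_fst).
Qed.

Let g_int : (\int[mu]_x (g x)%:E = 1)%E.
Proof. by rewrite -(X_law 0)// preimage_setT probability_setT. Qed.

(** G bounds the weight g, the middle factor is the integrated bias per unit of bandwidth, and 1 /
    (1 - alpha) comes from averaging the bandwidths. *)
Let C2 : R := G * (L * M + 2 * G * M) / (1 - alpha).

Let integral_bias_avg n : (0 < n)%N ->
  (\int[mu]_x (bias_avg n x * g x)%:E <= (C2 * n%:R `^ (- alpha))%:E)%E.
Proof.
move=> n0; have nn0 : 0 < n%:R :> R by rewrite ltr0n.
have bb0 k x : 0 <= bias_bound M G L (h k) x by exact: (bias_bound_ge0 g0 g_bound L0).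
have bias0 x : 0 <= bias_avg n x.
  by rewrite mulr_ge0 ?invr_ge0 ?(ltW nn0)// sumr_ge0.
have mb : measurable_fun setT (bias_avg n).
  apply: measurable_funM => //; apply: measurable_sum => k.
  exact: measurable_bias_bound.
have nV0 : 0 <= n%:R^-1 :> R by rewrite invr_ge0 ltW.
apply: (@le_trans _ _ (\int[mu]_(x in `[(- (1/2))%R, (1/2)%R])
    ((G * n%:R^-1)%:E * (\sum_(0 <= k < n) (bias_bound M G L (h k) x)%:E)))%E).
  rewrite [leRHS]integral_mkcond; apply: ge0_le_integral => //=.
  - by move=> x _; rewrite lee_fin mulr_ge0.
  - by apply/measurable_EFinP; exact: measurable_funM.
  - apply/(measurable_restrictT _ (measurable_itv _)); apply: measurable_funTS.
    apply: measurable_funeM; apply: emeasurable_sum => k; apply/measurable_EFinP.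
    exact: measurable_bias_bound.
  move=> x _; rewrite patchE; case: ifPn => [_|/negP xI].
    rewrite sumEFin -EFinM lee_fin /bias_avg [G * _]mulrC -!mulrA ler_wpM2l//.
    by rewrite [G * _]mulrC ler_wpM2l// sumr_ge0.
  rewrite g_supp ?mulr0// ltNge; apply/negP => xh; apply: xI.
  by rewrite inE/= in_itv/= -ler_norml.
rewrite ge0_integralZl//=; last 3 first.
- apply: emeasurable_sum => k; apply/measurable_EFinP/measurable_funTS.
  exact: measurable_bias_bound.
- by move=> x _; rewrite sume_ge0// => k _; rewrite lee_fin.
- by rewrite lee_fin mulr_ge0.
rewrite ge0_integral_sum//; last 2 first.
- by move=> k; apply/measurable_EFinP/measurable_funTS; exact: measurable_bias_bound.
- by move=> k x _; rewrite lee_fin.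
apply: (@le_trans _ _ ((G * n%:R^-1)%:E *
    (\sum_(0 <= k < n) ((L * M + 2 * G * M) * h k)%:E))%E).
  rewrite lee_wpmul2l ?lee_fin ?mulr_ge0//; apply: lee_sum => k _.
  exact: (integral_bias_bound g0 g_bound L0).
rewrite sumEFin -EFinM lee_fin -mulr_sumr.
have Hs : \sum_(0 <= k < n) h k <= (1 - alpha)^-1 * n%:R `^ (1 - alpha).
  by have := sum_powR_le n alpha01; rewrite big_add1.
have LM0 : 0 <= L * M + 2 * G * M by rewrite addr_ge0// !mulr_ge0.
apply: (@le_trans _ _ (G * n%:R^-1 * ((L * M + 2 * G * M) *
    ((1 - alpha)^-1 * n%:R `^ (1 - alpha))))).
  by rewrite ler_wpM2l ?mulr_ge0// ler_wpM2l.
rewrite powRD ?pnatr_eq0 ?(gtn_eqF n0) ?implybT// powRr1 ?ler0n//.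
rewrite le_eqVlt; apply/orP; left; apply/eqP; rewrite /C2.
have nV : n%:R^-1 * n%:R = 1 :> R by rewrite mulVf// gt_eqF.
transitivity (G * (L * M + 2 * G * M) / (1 - alpha) * n%:R `^ (- alpha) * (n%:R^-1 * n%:R)).
  by ring.
by rewrite nV mulr1.
Qed.

(** The variable w' supplies a copy of X_{n+1} independent of the sample behind [ghat]. Once the
    integrals are exchanged, the pointwise L^1 bound is integrated against g, which averages out the
    boundary layers. *)
Lemma ghat_mean_error n : (0 < n)%N ->
  (\int[P]_w \int[P]_w' `|ghat K alpha (fun n => X n : T -> R) n w (X n.+1 w') - g (X n.+1 w')|%:E
    <= ((Cv + 1) * n%:R `^ (- beta) + C2 * n%:R `^ (- alpha))%:E)%E.
Proof.
move=> n0.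
have mpsi : measurable_fun setT (fun z : hist n.+1.*2 * R =>
    `|ghat K alpha (fun n => X n : T -> R) n z.1 z.2 - g z.2|%:E).
  apply/measurable_EFinP; apply: measurableT_comp => //.
  apply: measurable_funB; first exact: ghat_meas.
  exact: (measurableT_comp mg).
rewrite (swap_X X_law mg g0 mpsi)//.
have bias0 x : 0 <= bias_avg n x.
  rewrite mulr_ge0 ?invr_ge0// sumr_ge0// => k _.
  exact: (bias_bound_ge0 g0 g_bound L0).
have mb : measurable_fun setT (bias_avg n).
  apply: measurable_funM => //; apply: measurable_sum => k.
  exact: measurable_bias_bound.
have c0 : 0 <= (Cv + 1) * n%:R `^ (- beta) by rewrite mulr_ge0 ?powR_ge0// addr_ge0.
apply: (@le_trans _ _ (\int[mu]_x (((Cv + 1) * n%:R `^ (- beta))%:E * (g x)%:E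
    + (bias_avg n x * g x)%:E))%E).
  apply: ge0_le_integral => //=.
  - move=> x _; apply: mule_ge0; last by rewrite lee_fin.
    by apply: integral_ge0 => w _; rewrite lee_fin.
  - apply: emeasurable_funM; last exact/measurable_EFinP.
    apply: (measurable_fun_fubini_tonelli_G (m1 := P)
      (fun z : T * R => `|ghat K alpha (fun n => X n : T -> R) n z.1 z.2 - g z.2|%:E)) => //.
    apply/measurable_EFinP; apply: measurableT_comp => //.
    apply: measurable_funB; last exact: (measurableT_comp mg).
    apply: (@measurable_ghat _ T R (fun n => X n : T -> R) K alpha mK _ _ fst snd n) => // i _.
    by apply: measurableT_comp => //.
  - apply: emeasurable_funD; first by apply: measurable_funeM; exact/measurable_EFinP.
    by apply/measurable_EFinP; exact: measurable_funM.
  move=> x _; have [xh|xh] := leP `|x| (1/2); last first.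
    by rewrite g_supp// !mulr0 !mule0 adde0.
  rewrite -EFinM -EFinD -mulrDl EFinM lee_wpmul2r ?lee_fin//.
  exact: ghat_L1.
rewrite ge0_integralD//=; last 4 first.
- by move=> x _; rewrite mule_ge0// lee_fin.
- by apply: measurable_funeM; exact/measurable_EFinP.
- by move=> x _; rewrite lee_fin mulr_ge0.
- by apply/measurable_EFinP; exact: measurable_funM.
rewrite ge0_integralZl//=; last 2 first.
- exact/measurable_EFinP.
- by move=> x _; rewrite lee_fin.
by rewrite g_int mule1 EFinD leeD2l// integral_bias_avg.
Qed.

(** For a >= 0 one has exp(-a) <= 1/(1+a) <= 1 - a + a^2; after integration, 1 + t <= exp t restores
    an exponential. *)
Let laplace1 x k lam : 0 <= lam ->
  (\int[P]_w (expR (- (lam * v x k w)))%:E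
    <= (expR (- (lam * m x k) + lam ^+ 2 * ((h k)^-1 * Kb * G)))%:E)%E.
Proof.
move=> lam0.
have me : measurable_fun setT (fun w => expR (- (lam * v x k w))).
  by apply: (measurableT_comp (@measurable_expR R)); apply: measurableT_comp => //; exact: measurable_funM.
apply: (@le_trans _ _ (1 - lam * m x k + lam ^+ 2 * ((h k)^-1 * Kb * G))%:E); last first.
  by rewrite lee_fin -addrA expR_ge1Dx.
(* The linear term is kept on the left so that only nonnegative functions are integrated. *)
have H : (\int[P]_w (expR (- (lam * v x k w)))%:E + lam%:E * (m x k)%:E
    <= 1 + (lam ^+ 2)%:E * ((h k)^-1 * Kb * G)%:E)%E.
  rewrite -Ev -ge0_integralZl//=; last 2 first.
  - exact/measurable_EFinP.
  - by move=> w _; rewrite lee_fin.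
  rewrite -ge0_integralD//=; last 3 first.
  - exact/measurable_EFinP.
  - by move=> w _; rewrite mule_ge0// lee_fin.
  - by apply: measurable_funeM; exact/measurable_EFinP.
  apply: (@le_trans _ _ (\int[P]_w (1%:E + (lam ^+ 2)%:E * (v x k w ^+ 2)%:E))%E).
    apply: ge0_le_integral => //=.
    - by move=> w _; rewrite adde_ge0 ?mule_ge0 ?lee_fin.
    - apply: emeasurable_funD; first exact/measurable_EFinP.
      by apply: measurable_funeM; exact/measurable_EFinP.
    - apply: emeasurable_funD => //; apply: measurable_funeM.
      by apply/measurable_EFinP; exact: measurable_funX.
    move=> w _; rewrite -!EFinM -!EFinD lee_fin -exprMn.
    have : 0 <= lam * v x k w by rewrite mulr_ge0.
    move: (lam * v x k w) => a a0; rewrite expRN.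
    have a1 : 0 < 1 + a by lra.
    have : (expR a)^-1 <= (1 + a)^-1 by rewrite lef_pV2 ?posrE ?expR_gt0// expR_ge1Dx.
    have : (1 + a)^-1 <= 1 - a + a ^+ 2.
      rewrite -[leLHS]mul1r ler_pdivrMr// (_ : _ * _ = 1 + a ^+ 3); last by ring.
      by rewrite lerDl exprn_ge0.
    lra.
  rewrite ge0_integralD//=; last 2 first.
  - by move=> w _; rewrite mule_ge0// lee_fin sqr_ge0.
  - by apply: measurable_funeM; apply/measurable_EFinP; exact: measurable_funX.
  rewrite integral_cst1 leeD2l// ge0_integralZl//=; last 3 first.
  - by apply/measurable_EFinP; exact: measurable_funX.
  - by move=> w _; rewrite lee_fin sqr_ge0.
  - by rewrite lee_fin sqr_ge0.
  by rewrite lee_wpmul2l// lee_fin sqr_ge0.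
have : (\int[P]_w (expR (- (lam * v x k w)))%:E <=
    1 + (lam ^+ 2)%:E * ((h k)^-1 * Kb * G)%:E - (lam * m x k)%:E)%E.
  by rewrite leeBrDr// EFinM.
move/le_trans; apply.
rewrite [leLHS](_ : _ = (1 + lam ^+ 2 * ((h k)^-1 * Kb * G) - lam * m x k)%:E)//.
by rewrite lee_fin; lra.
Qed.


Let S x n w : R := \sum_(0 <= k < n) v x k w.

Let mS x n : measurable_fun setT (S x n).
Proof. exact: measurable_sum. Qed.

(** Each step of the induction splits off the last summand by freezing the past, and the Laplace
    transforms multiply. *)
Let laplace x n lam : 0 <= lam ->
  (\int[P]_w (expR (- (lam * S x n w)))%:E
    <= (expR (\sum_(0 <= k < n) (- (lam * m x k) + lam ^+ 2 * ((h k)^-1 * Kb * G))))%:E)%E.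
Proof.
move=> lam0; elim: n => [|n IH].
  rewrite big_geq// /S; under eq_integral do rewrite big_geq// mulr0 oppr0.
  by rewrite integral_cst1.
pose psi (z : hist n.+1.*2 * R) : \bar R :=
  ((expR (- (lam * S x n z.1)))%:E * (expR (- (lam * scaled_kernel K (h n) x z.2)))%:E)%E.
have mexp d' (E : measurableType d') (u : E -> R) : measurable_fun setT u ->
    measurable_fun setT (fun e => (expR (- (lam * u e)))%:E).
  move=> mu_; apply/measurable_EFinP; apply: (measurableT_comp (@measurable_expR R)).
  by apply: measurableT_comp => //; exact: measurable_funM.
have mpsi : measurable_fun setT psi.
  apply: emeasurable_funM.
    apply: (mexp _ _ (fun z : hist n.+1.*2 * R => S x n z.1)).
    have mSh : measurable_fun setT (S x n : hist n.+1.*2 -> R).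
      rewrite (_ : S x n = fun w => \sum_(k < n) v x k w); last first.
        by apply/funext => w; rewrite /S big_mkord.
      by apply: measurable_sum => k; exact: hist_v.
    exact: (measurableT_comp mSh measurable_fst).
  apply: (mexp _ _ (fun z : hist n.+1.*2 * R => scaled_kernel K (h n) x z.2)).
  exact: (measurableT_comp (mV x n) measurable_snd).
have psi0 z : (0 <= psi z)%E by rewrite mule_ge0// lee_fin expR_ge0.
have -> : (\int[P]_w (expR (- (lam * S x n.+1 w)))%:E
    = \int[P]_w psi (w : hist n.+1.*2, X n.+1 w))%E.
  apply: eq_integral => w _; rewrite /psi /= -EFinM -expRD -opprD -mulrDr.
  by rewrite /S big_nat_recr.
rewrite (freezing_X indep mpsi psi0) /psi /=.
under eq_integral => w _.
  rewrite ge0_integralZl//=; last exact: (mexp _ _ _ (mv x n)).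
  over.
pose J := (\int[P]_w' (expR (- (lam * scaled_kernel K (h n) x (X n.+1 w'))))%:E)%E.
rewrite -/J.
have J0 : (0 <= J)%E by apply: integral_ge0 => w _; rewrite lee_fin expR_ge0.
have -> : (\int[P]_w ((expR (- (lam * S x n w)))%:E * J)
    = (\int[P]_w (expR (- (lam * S x n w)))%:E) * J)%E.
  apply: ge0_integralZr => //; first [exact: mexp|by move=> *; rewrite lee_fin expR_ge0].
rewrite big_nat_recr//= expRD EFinM; apply: lee_pmul => //.
- by apply: integral_ge0 => w _; rewrite lee_fin expR_ge0.
- exact: laplace1.
Qed.

Let bandwidth_small : exists k0, forall k, (k0 <= k)%N -> h k * M <= 1/2.
Proof.
have /andP[a0 _] := alpha01.
exists (Num.truncn ((2 * M) `^ alpha^-1)) => k kk.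
have H : (2 * M) `^ alpha^-1 <= k.+1%:R.
  by apply: le_trans (ltW (truncnS_gt _)) _; rewrite ler_nat.
have H2 : 2 * M <= k.+1%:R `^ alpha.
  have M20 : 0 <= 2 * M by rewrite mulr_ge0.
  have -> : 2 * M = ((2 * M) `^ alpha^-1) `^ alpha.
    by rewrite -powRrM mulVf ?powRr1// gt_eqF.
  by apply: ge0_ler_powR => //; rewrite ?nnegrE ?powR_ge0 ?(ltW a0).
rewrite /h /bandwidth powRN mulrC ler_pdivrMr ?powR_gt0// ?ltr0n//.
lra.
Qed.

(** Half of the lower bound gmin/2 for the smoothed density: falling below c is a deviation from the
    mean by a fixed factor. *)
Let c : R := gmin / 4.

Let c0 : 0 < c. Proof. by rewrite divr_gt0. Qed.

(** The first k0 bandwidths may be too wide for the lower bound on the mean; those terms are merely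
    nonnegative, which costs a constant. *)
Let mean_sum x n k0 : (forall k, (k0 <= k)%N -> h k * M <= 1/2) -> `|x| <= 1/2 ->
  2 * c * (n%:R - k0%:R) <= \sum_(0 <= k < n) m x k.
Proof.
move=> hk0 xh; elim: n => [|n IH].
  by rewrite big_geq// sub0r mulrN oppr_le0 !mulr_ge0// ltW.
have [nk|nk] := ltnP n k0.
  apply: (@le_trans _ _ 0); last by apply: sumr_ge0.
  apply: mulr_ge0_le0; first by rewrite mulr_ge0// ltW.
  by rewrite subr_le0 ler_nat.
rewrite big_nat_recr//= -natr1.
have : 2 * c <= m x n.
  rewrite -lee_fin -mfin.
  have := kernel_mean_ge K0 K_even K_cont K_supp K_int g0 mg (ltW gmin0) g_min (h_gt0 n) (hk0 _ nk) xh.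
  apply: le_trans; rewrite lee_fin /c; lra.
move: IH; lra.
Qed.

(* Chernoff's bound is applied at tau * n^(-alpha); this tau makes the quadratic
   term of the exponent at most half of the linear one. *)
Let tau : R := c / (2 * (Kb * G + 1)).

Let tau0 : 0 < tau.
Proof. by rewrite divr_gt0// mulr_gt0// ltr_wpDl// mulr_ge0. Qed.

(** With q = n^(1 - alpha), the exponent is at most tau c q from the threshold, minus 2 tau c q from
    the mean, plus tau c q / 2 from the quadratic term, up to the constant 2 c k0 tau. *)
Let lower_tail_at x n k0 : (forall k, (k0 <= k)%N -> h k * M <= 1/2) -> `|x| <= 1/2 ->
  (0 < n)%N ->
  (\int[P]_w ((ghat K alpha (fun n => X n : T -> R) n w x < c)%R%:R)%:E
    <= (expR (2 * c * k0%:R * tau) * expR (- (c * tau / 2 * n%:R `^ (1 - alpha))))%:E)%E.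
Proof.
move=> hk0 xh n0; have nn0 : 0 < n%:R :> R by rewrite ltr0n.
have /andP[a0 a1] := alpha01.
pose lam := tau * n%:R `^ (- alpha).
have na1 : n%:R `^ (- alpha) <= 1 :> R.
  rewrite -[leRHS](powRr0 n%:R) ler_powR ?ler1n//; lra.
have na0 : 0 <= n%:R `^ (- alpha) :> R by exact: powR_ge0.
have lam0 : 0 <= lam by rewrite mulr_ge0// ltW.
have lam_tau : lam <= tau by rewrite ler_piMr// ltW.
have mexp : measurable_fun setT (fun w => expR (- (lam * S x n w))).
  apply: (measurableT_comp (@measurable_expR R)).
  by apply: measurableT_comp => //; exact: measurable_funM.
apply: (@le_trans _ _ (\int[P]_w ((expR (lam * (n%:R * c)))%:E *
    (expR (- (lam * S x n w)))%:E))%E).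
  apply: ge0_le_integral => //=.
  - apply/measurable_EFinP.
    apply: (@measurableT_comp _ _ _ _ _ _ (fun b : bool => b%:R : R)) => //.
    apply: measurable_fun_ltr => //; under eq_fun do rewrite ghatE.
    by apply: measurable_funM => //; exact: mS.
  - by apply: measurable_funeM; exact/measurable_EFinP.
  move=> w _; rewrite -EFinM lee_fin -expRD -mulrN -mulrDr.
  case: ltP => [H|_]; last by rewrite expR_ge0.
  rewrite -[leLHS]expR0 ler_expR mulr_ge0// subr_ge0.
  move: H; rewrite ghatE mulrC ltr_pdivrMr// => /ltW.
  by rewrite mulrC.
rewrite ge0_integralZl//=; last exact/measurable_EFinP.
apply: (@le_trans _ _ ((expR (lam * (n%:R * c)))%:E *
  (expR (\sum_(0 <= k < n) (- (lam * m x k) + lam ^+ 2 * ((h k)^-1 * Kb * G))))%:E)%E).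
  by rewrite lee_wpmul2l ?lee_fin ?expR_ge0// laplace.
rewrite -EFinM lee_fin -!expRD ler_expR big_split/= sumrN -!mulr_sumr.
have Hm := mean_sum n hk0 xh.
have Hh : \sum_(0 <= k < n) ((h k)^-1 * Kb * G) <= n%:R * n%:R `^ alpha * (Kb * G).
  apply: (@le_trans _ _ (\sum_(0 <= k < n) (n%:R `^ alpha * (Kb * G)))).
    rewrite big_seq [leRHS]big_seq; apply: ler_sum => k.
    rewrite mem_index_iota => /andP[_ kn]; rewrite -mulrA ler_wpM2r ?mulr_ge0//.
    exact: hV_le.
  by rewrite sumr_const_nat subn0 -[leLHS]mulr_natl mulrA.
set q := n%:R `^ (1 - alpha).
have q0 : 0 <= q by exact: powR_ge0.
have q1 : lam * n%:R = tau * q.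
  rewrite /lam -mulrA; congr (_ * _).
  by rewrite /q addrC powRD ?pnatr_eq0 ?(gtn_eqF n0) ?implybT// powRr1 ?ler0n.
have q2 : lam ^+ 2 * (n%:R * n%:R `^ alpha) = tau ^+ 2 * q.
  rewrite expr2 mulrACA q1 -mulrA; rewrite expr2 -mulrA; congr (_ * _).
  rewrite mulrC; congr (_ * _); rewrite /lam -mulrA powRN mulVf ?mulr1//.
  by rewrite gt_eqF// powR_gt0.
have A1 : lam ^+ 2 * \sum_(0 <= k < n) ((h k)^-1 * Kb * G) <= tau ^+ 2 * q * (Kb * G).
  by rewrite -q2 -mulrA ler_wpM2l ?sqr_ge0.
have A2 : lam * (2 * c * (n%:R - k0%:R)) <= lam * \sum_(0 <= k < n) m x k.
  by rewrite ler_wpM2l.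
have KG0 : 0 <= Kb * G by rewrite mulr_ge0.
have tauE : tau * (2 * (Kb * G + 1)) = c.
  by rewrite /tau divfK// gt_eqF// mulr_gt0// ltr_wpDl.
have A3 : tau * (Kb * G) <= c / 2.
  have : 0 <= tau by exact: ltW.
  by move: tauE; lra.
have A4 : tau ^+ 2 * q * (Kb * G) <= c * tau / 2 * q.
  have -> : tau ^+ 2 * q * (Kb * G) = (tau * (Kb * G)) * (tau * q) by ring.
  have -> : c * tau / 2 * q = c / 2 * (tau * q) by field.
  by rewrite ler_wpM2r// mulr_ge0// ltW.
have A5 : lam * k0%:R * (2 * c) <= tau * k0%:R * (2 * c).
  by apply: ler_wpM2r; [rewrite mulr_ge0// ltW|rewrite ler_wpM2r].
have A6 : lam * (n%:R * c) = tau * q * c by rewrite mulrA q1.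
have A7 : lam * (2 * c * (n%:R - k0%:R)) = 2 * (tau * q * c) - lam * k0%:R * (2 * c).
  by rewrite -q1; ring.
rewrite A7 in A2; rewrite A6.
have -> : c * tau / 2 * q = (tau * q * c) / 2 by field.
have : c * tau / 2 * q = (tau * q * c) / 2 by field.
move: A1 A2 A4 A5; lra.
Qed.

Lemma ghat_lower_tail : exists C c' : R, 0 < c' /\ forall n, (0 < n)%N ->
  (\int[P]_w ((ghat K alpha (fun n => X n : T -> R) n w (X n.+1 w) < gmin / 4)%R%:R)%:E
    <= (C * expR (- (c' * n%:R `^ (1 - alpha))))%:E)%E.
Proof.
have [k0 hk0] := bandwidth_small.
exists (expR (2 * c * k0%:R * tau)), (c * tau / 2); split.
  by rewrite divr_gt0// mulr_gt0.
move=> n n0; set bnd := _ * expR _.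
have bnd0 : 0 <= bnd by rewrite mulr_ge0 ?expR_ge0.
have mlt d' (E : measurableType d') (u : E -> R) : measurable_fun setT u ->
    measurable_fun setT (fun e => ((u e < c)%R%:R)%:E : \bar R).
  move=> mu_; apply/measurable_EFinP.
  apply: (@measurableT_comp _ _ _ _ _ _ (fun b : bool => b%:R : R)) => //.
  exact: measurable_fun_ltr.
have mpsi := mlt _ _ _ (@ghat_meas n).
rewrite (freezing_X indep (n := n.+1) mpsi); last by move=> z; rewrite lee_fin.
rewrite (swap_X X_law mg g0 mpsi); last by move=> z; rewrite lee_fin.
apply: (@le_trans _ _ (\int[mu]_x (bnd%:E * (g x)%:E))%E).
  apply: ge0_le_integral => //=.
  - move=> x _; rewrite mule_ge0 ?lee_fin//.
    by apply: integral_ge0 => w _; rewrite lee_fin.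
  - apply: emeasurable_funM; last exact/measurable_EFinP.
    apply: (measurable_fun_fubini_tonelli_G (m1 := P)
      (fun z : T * R => ((ghat K alpha (fun n => X n : T -> R) n z.1 z.2 < c)%R%:R)%:E)).
      apply: mlt.
      apply: (@measurable_ghat _ T R (fun n => X n : T -> R) K alpha mK _ _ fst snd n) => // i _.
      by apply: measurableT_comp => //.
    by move=> z; rewrite lee_fin.
  - by apply: measurable_funeM; exact/measurable_EFinP.
  move=> x _; have [xh|xh] := leP `|x| (1/2); last by rewrite g_supp// !mule0.
  by rewrite lee_wpmul2r ?lee_fin// lower_tail_at.
rewrite ge0_integralZl//=; last 2 first.
- exact/measurable_EFinP.
- by move=> x _; rewrite lee_fin.
by rewrite g_int mule1.
Qed.

End density_estimate.

(** * Integrals over a period *)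

Section period_integrals.
Context (R : realType).
Notation mu := (@lebesgue_measure R).
Let J : set R := `[(- (1/2))%R, (1/2)%R]%classic.

Let mJ : measurable J. Proof. exact: measurable_itv. Qed.

Let muJ : mu J = 1%E.
Proof.
by rewrite lebesgue_measure_itv/= lte_fin ifT; [rewrite -EFinB; congr EFin; lra|lra].
Qed.

Lemma bounded_integrable_period (q : R -> R) (C : R) : measurable_fun setT q ->
  (forall x, `|q x| <= C) -> mu.-integrable J (EFin \o q).
Proof.
move=> mq qC; apply: measurable_bounded_integrable => //.
- by rewrite [X in (X < _)%E](_ : _ = 1%E) ?ltry//; exact: muJ.
- exact: measurable_funTS.
exists C; split; first by rewrite num_real.
by move=> x Cx w _; apply: le_trans (qC w) (ltW Cx).
Qed.

(* Adding the constant C reduces a change of variables for bounded signed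
   functions to the nonnegative case. *)
Let bounded_transport (q r : R -> R) (C : R) :
  measurable_fun setT q -> (forall x, `|q x| <= C) ->
  measurable_fun setT r -> (forall x, `|r x| <= C) ->
  (\int[mu]_(x in J) (q x + C)%:E = \int[mu]_(x in J) (r x + C)%:E)%E ->
  \int[mu]_(x in J) q x = \int[mu]_(x in J) r x.
Proof.
move=> mq qC mr rC E.
have ic : mu.-integrable J (EFin \o (fun _ : R => C)).
  exact: (@bounded_integrable_period _ `|C|).
have : \int[mu]_(x in J) (q x + C) = \int[mu]_(x in J) (r x + C) by rewrite /Rintegral E.
have split_cst (p : R -> R) : measurable_fun setT p -> (forall x, `|p x| <= C) ->
    \int[mu]_(x in J) (p x + C) = \int[mu]_(x in J) p x + \int[mu]_(x in J) C.
  move=> mp pC; rewrite RintegralD//; exact: bounded_integrable_period mp pC.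
by rewrite !split_cst//; exact: addIr.
Qed.

Lemma ge0_integral_itv_shift (q : R -> R) (a b s : R) : measurable_fun setT q ->
  (forall x, 0 <= q x) ->
  (\int[mu]_(x in `[(a + s)%R, (b + s)%R[) (q (x - s))%:E
    = \int[mu]_(x in `[a, b[) (q x)%:E)%E.
Proof.
move=> mq q0; rewrite integral_mkcond [RHS]integral_mkcond.
pose phi := (q \_ `[a, b[%classic).
have mphi : measurable_fun setT phi.
  by apply/(measurable_restrictT _ (measurable_itv _))/measurable_funTS.
have phi0 u : 0 <= phi u by rewrite /phi patchE; case: ifP.
transitivity (\int[mu]_x (phi x)%:E)%E; last first.
  by rewrite restrict_EFin.
rewrite -(@ge0_integral_affine R 1 s phi)//; apply: eq_integral => x _.
rewrite invr1 mul1r mulr1 /phi !patchE.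
have -> : (x \in `[a + s, b + s[%classic) = (x - s \in `[a, b[%classic).
  by rewrite !mem_setE !in_itv/= lerBrDr ltrBlDr.
by case: ifP.
Qed.

(** A shift by 0 <= t < 1 moves the piece [-1/2 - t, -1/2[ out of the period; translated by 1 it
    becomes [1/2 - t, 1/2[. Half-open intervals make the pieces fit exactly, and a negative shift is
    reduced to this case by adding 1. *)
Lemma ge0_integral_period_shift (q : R -> R) (s : R) : measurable_fun setT q ->
  (forall x, 0 <= q x) -> (forall x, q (x + 1) = q x) -> `|s| < 1 ->
  (\int[mu]_(x in J) (q (x - s))%:E = \int[mu]_(x in J) (q x)%:E)%E.
Proof.
move=> mq q0 qp.
suff core t : 0 <= t < 1 ->
    (\int[mu]_(x in J) (q (x - t))%:E = \int[mu]_(x in J) (q x)%:E)%E.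
  rewrite ltr_norml => /andP[s1 s2]; have [s0|s0] := leP 0 s.
    by apply: core; rewrite s0.
  rewrite -(core (s + 1)); last by apply/andP; split; lra.
  by apply: eq_integral => x _; rewrite -[in RHS]qp; congr (q _)%:E; ring.
move=> /andP[t0 t1].
have mqt : measurable_fun setT (fun x : R => q (x - t)).
  by apply: (measurableT_comp mq); exact: measurable_funB.
have mE (p : R -> R) (D : set R) : measurable_fun setT p ->
    measurable_fun D (fun x => (p x)%:E).
  by move=> mp; apply/measurable_EFinP/measurable_funTS.
rewrite /J -!integral_itv_bndo_bndc; [|exact: mE|exact: mE].
rewrite [LHS](_ : _ = \int[mu]_(x in `[(- (1/2) - t + t)%R, (1/2 - t + t)%R[)
  (q (x - t))%:E)%E; last by rewrite !subrK.
rewrite ge0_integral_itv_shift//.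
rewrite (@itv_bndbnd_setU _ _ _ (BLeft (- (1/2)))); last 2 first.
- by rewrite bnd_simp; lra.
- by rewrite bnd_simp; lra.
rewrite [in RHS](@itv_bndbnd_setU _ _ _ (BLeft (1/2 - t))); last 2 first.
- by rewrite bnd_simp; lra.
- by rewrite bnd_simp; lra.
have disj (a b c : R) : [disjoint `[a, b[%classic & `[b, c[%classic].
  apply/disj_setPS => y [/=]; rewrite !in_itv/= => /andP[_ yb] /andP[].
  by rewrite leNgt yb.
rewrite !ge0_integral_setU//=; try exact: mE; try exact: disj;
  try by move=> x _; rewrite lee_fin.
rewrite addeC; congr (_ + _)%E.
have := @ge0_integral_itv_shift q (- (1/2) - t) (- (1/2)) 1 mq q0.
rewrite (_ : - (1/2) - t + 1 = 1/2 - t); last by lra.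
rewrite (_ : - (1/2) + 1 = 1/2 :> R); last by lra.
by move=> <-; apply: eq_integral => x _; rewrite -[in RHS](subrK 1 x) qp.
Qed.

Lemma ge0_integral_opp (q : R -> R) : measurable_fun setT q -> (forall x, 0 <= q x) ->
  (\int[mu]_(x in J) (q (- x))%:E = \int[mu]_(x in J) (q x)%:E)%E.
Proof.
move=> mq q0.
pose N : measurableTypeR R -> measurableTypeR R := -%R.
have mN : measurable_fun setT N by exact: (@oppr_measurable R setT).
pose pm : {measure set (measurableTypeR R) -> \bar R} :=
  measure_function_pushforward__canonical__measure_function_Measure mu mN.
have NJ : N @^-1` J = J.
  by apply/seteqP; split=> x /=; rewrite /N/J/= !in_itv/= => /andP[? ?]; apply/andP; split; lra.
transitivity (\int[pm]_(x in J) (q x)%:E)%E.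
  have := @ge0_integral_pushforward _ _ _ _ _ N mN mu J (fun u => (q u)%:E) mJ.
  rewrite NJ => ->//; first by apply/measurable_EFinP/measurable_funTS.
  by move=> x _; rewrite lee_fin.
by apply: eq_measure_integral => A mA _; exact: lebesgue_measureN.
Qed.

Variables (f : R -> R) (F : R).
Hypothesis mf : measurable_fun setT f.
Hypothesis f_even : forall x, f (- x) = f x.
Hypothesis f_bound : forall x, `|f x| <= F.
Hypothesis f_per : forall x, f (x + 1) = f x.

Let F0 : 0 <= F. Proof. exact: le_trans (f_bound 0). Qed.

Let msin (u : R -> R) : measurable_fun setT u -> measurable_fun setT (fun x => sin (u x)).
Proof. exact: (measurableT_comp (continuous_measurable_fun (@continuous_sin R))). Qed.

Let mcos (u : R -> R) : measurable_fun setT u -> measurable_fun setT (fun x => cos (u x)).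
Proof. exact: (measurableT_comp (continuous_measurable_fun (@continuous_cos R))). Qed.

Let bnd (r x : R) : `|r| <= 1 -> `|r * f x| <= F.
Proof. by move=> r1; rewrite normrM -[leRHS]mul1r ler_pM. Qed.

(** Translation by theta centres f; in the addition formula for the sine, the term with sin(2 pi x)
    f(x) is odd and vanishes, and the cosine term is the first Fourier coefficient of f. *)
Lemma sin_moment (theta t : R) : `|theta| < 1 ->
  \int[mu]_(x in J) (sin (2 * pi * (x - t)) * f (x - theta))
    = (\int[mu]_(x in J) (cos (2 * pi * x) * f x)) * sin (2 * pi * (theta - t)).
Proof.
move=> th1; set a := 2 * pi * (theta - t).
pose q (x : R) := sin (2 * pi * x + a) * f x.
have mq : measurable_fun setT q.
  by apply: measurable_funM => //; apply: msin; exact: measurable_funD.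
have qF x : `|q x| <= F by apply: bnd; exact: sin_max.
have qp x : q (x + 1) = q x.
  rewrite /q f_per; congr (_ * _).
  rewrite -[RHS]sinD2pi; congr sin; rewrite -[pi *+ 2]mulr_natl; ring.
have -> : \int[mu]_(x in J) (sin (2 * pi * (x - t)) * f (x - theta)) =
    \int[mu]_(x in J) q x.
  transitivity (\int[mu]_(x in J) q (x - theta)).
    apply: eq_Rintegral => x _; rewrite /q; congr (sin _ * _).
    by rewrite /a; ring.
  apply: (@bounded_transport _ _ F) => //.
    by apply: (measurableT_comp mq); exact: measurable_funB.
  apply: (@ge0_integral_period_shift (fun x => q x + F)) => //.
  - exact: measurable_funD.
  - by move=> x; have := qF x; rewrite ler_norml => /andP[? ?]; lra.
  - by move=> x; rewrite qp.
pose o (x : R) := sin (2 * pi * x) * f x.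
have mo : measurable_fun setT o by apply: measurable_funM => //; exact: msin.
have oF x : `|o x| <= F by apply: bnd; exact: sin_max.
have o0 : \int[mu]_(x in J) o x = 0.
  have : \int[mu]_(x in J) o (- x) = \int[mu]_(x in J) o x.
    apply: (@bounded_transport _ _ F) => //.
      by apply: (measurableT_comp mo).
    apply: (@ge0_integral_opp (fun x => o x + F)).
      exact: measurable_funD.
    by move=> x; have := oF x; rewrite ler_norml => /andP[? ?]; lra.
  rewrite (_ : \int[mu]_(x in J) o (- x) = \int[mu]_(x in J) (-1 * o x)); last first.
    by apply: eq_Rintegral => x _; rewrite /o mulrN sinN f_even mulN1r mulNr.
  rewrite RintegralZl//; last exact: (bounded_integrable_period mo oF).
  by lra.
pose e (x : R) := cos (2 * pi * x) * f x.
have me : measurable_fun setT e by apply: measurable_funM => //; exact: mcos.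
have eF x : `|e x| <= F by apply: bnd; exact: cos_max.
have io := bounded_integrable_period mo oF.
have ie := bounded_integrable_period me eF.
transitivity (\int[mu]_(x in J) (o x * cos a + e x * sin a)).
  by apply: eq_Rintegral => x _; rewrite /q /o /e sinD; ring.
rewrite RintegralD//; last 2 first.
- apply: (@bounded_integrable_period _ F); first exact: measurable_funM.
  by move=> x; rewrite normrM -[leRHS]mulr1 ler_pM// cos_max.
- apply: (@bounded_integrable_period _ F); first exact: measurable_funM.
  by move=> x; rewrite normrM -[leRHS]mulr1 ler_pM// sin_max.
by rewrite !RintegralZr// o0 mul0r add0r.
Qed.

End period_integrals.

(** * The projected recursion *)

Section projected_recursion.
Context (R : realType).

Lemma projC_bound (x : R) : `|projC x| <= 1/4.
Proof. rewrite /projC; case: (leP (1/4) x) => [_|?]; first by rewrite ger0_norm; lra.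
by case: (leP x _) => ?; rewrite ler_norml; apply/andP; split; lra. Qed.

Lemma projCN (x : R) : projC (- x) = - projC x.
Proof.
rewrite /projC.
by case: (leP (1/4) x) => ?; case: (leP x (- (1/4))) => ?; case: (leP (1/4) (- x)) => ?;
  case: (leP (- x) (- (1/4))) => ?; lra.
Qed.

Lemma harmonic_unbounded (B : R) : exists n, B < series harmonic n.
Proof.
apply: contrapT => H; apply: (@dvg_harmonic R); apply: nondecreasing_is_cvgn.
  by apply: nondecreasing_series => n _ _; exact: harmonic_ge0.
exists B => _ [n _ <-]; rewrite leNgt; apply/negP => Bn; apply: H; by exists n.
Qed.

Lemma sin_ge0_half (x : R) : 0 <= x <= 1/2 -> 0 <= sin (2 * pi * x).
Proof.
move=> /andP[x0 x1]; have pi0 := pi_gt0 R; apply: sin_ge0_pi.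
rewrite mulr_ge0//; last by rewrite mulr_ge0// ltW.
by rewrite mulrAC -[leRHS]mul1r ler_pM2r//; lra.
Qed.

Lemma sin_lower_bound (hi eta : R) : hi < 1/2 -> 0 < eta ->
  exists2 k, 0 < k & forall x, eta <= x <= hi -> k <= sin (2 * pi * x).
Proof.
move=> hi2 eta0; have pi0 := pi_gt0 R.
have [hieta|etahi] := ltP hi eta.
  by exists 1 => // x /andP[a b]; have := le_trans a b; rewrite leNgt hieta.
have cs : {within `[eta, hi], continuous (fun x : R => sin (2 * pi * x))}.
  apply: continuous_subspaceT => x; apply: continuous_comp; last exact: continuous_sin.
  by apply: continuousM; [exact: cst_continuous|exact: cvg_id].
have [c] := EVT_min etahi cs.
rewrite in_itv/= => /andP[c1 c2] cmin.
exists (sin (2 * pi * c)); last by move=> x xI; apply: cmin; rewrite in_itv.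
apply: sin_gt0_pi; rewrite mulr_gt0/=; [|by rewrite mulr_gt0|lra].
by rewrite mulrAC -[ltRHS]mul1r ltr_pM2r//; lra.
Qed.

(** The unprojected step with its random increment split into the mean field and an arbitrary
    remainder [r], for one fixed outcome. *)
Definition sine_step (theta a : R) (t r : nat -> R) (n : nat) : R :=
  t n + Num.sg a * (n.+1%:R)^-1 * (a * sin (2 * pi * (theta - t n)) + r n).

Lemma sine_stepE (theta a : R) t r n : sine_step theta a t r n =
  t n - harmonic n * (`|a| * sin (2 * pi * (t n - theta)))
    + Num.sg a * ((n.+1%:R)^-1 * r n).
Proof.
rewrite /sine_step /= -(opprB (t n)) mulrN sinN normrEsg.
by move: (Num.sg a) (sin _) => s y; ring.
Qed.

(** Projection is harmless for an upper bound: clipping at 1/4 lowers t, and clipping at -1/4 puts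
    it below theta. As t - theta <= 1/4 - theta < 1/2, the sine is positive at every positive value
    of t - theta, and bounded below away from 0. *)
Lemma sine_step_le (theta a : R) t r : `|theta| < 1/4 -> a != 0 ->
  (forall n, `|t n| <= 1/4) ->
  (forall n, (0 < n)%N -> t n.+1 = projC (sine_step theta a t r n)) ->
  cvgn (series (fun n => (n.+1%:R)^-1 * r n)) ->
  forall eta, 0 < eta -> exists N, forall n, (N <= n)%N -> t n - theta <= eta.
Proof.
move=> th a0 tb tS rc.
have /andP[th1 th2] : - (1/4) < theta < 1/4 by rewrite -ltr_norml.
have a0' : 0 < `|a| by rewrite normr_gt0.
apply: (@one_sided_descent R 1 (fun n => t n - theta)
  (fun n => Num.sg a * ((n.+1%:R)^-1 * r n)) harmonic
  (fun x => `|a| * sin (2 * pi * x)) (1/4 - theta) `|a|).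
- move=> n n0; rewrite tS//.
  rewrite [X in _ \/ _ <= X](_ : _ = sine_step theta a t r n - theta); last first.
    by rewrite sine_stepE; ring.
  rewrite /projC; case: (leP (1/4)) => h1; first by right; lra.
  by case: (leP _ (- (1/4))) => h2; [left; lra|right].
- by move=> n; have := tb n; rewrite ler_norml => /andP[? ?]; lra.
- move=> x /andP[x1 x2]; rewrite mulr_ge0// sin_ge0_half//.
  by apply/andP; split; lra.
- move=> eta eta0; have [|k k0 H] := @sin_lower_bound (1/4 - theta) eta _ eta0; first by lra.
  by exists (`|a| * k) => [|x xI]; [exact: mulr_gt0|rewrite ler_pM2l// H].
- by move=> x; rewrite normrM normr_id -[leRHS]mulr1 ler_wpM2l// sin_max.
- exact: harmonic_ge0.
- exact: cvg_harmonic.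
- exact: harmonic_unbounded.
- exact: (@is_cvg_seriesZ _ (fun n => (n.+1%:R)^-1 * r n) (Num.sg a)).
Qed.

(** The lower bound is the upper bound for the reflected recursion, with signs of t, theta and r
    changed. The unprojected steps have the same limit, since they differ from t by a vanishing gain
    times a bounded term and by the general term of a convergent series. *)
Lemma sine_step_cvg (theta a : R) t r : `|theta| < 1/4 -> a != 0 ->
  (forall n, `|t n| <= 1/4) ->
  (forall n, (0 < n)%N -> t n.+1 = projC (sine_step theta a t r n)) ->
  cvgn (series (fun n => (n.+1%:R)^-1 * r n)) ->
  t n @[n --> \oo] --> theta /\
  finite_set [set n | (0 < n)%N /\ ~ (`|sine_step theta a t r n| <= 1/4)].
Proof.
move=> th a0 tb tS rc.
have up := sine_step_le th a0 tb tS rc.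
have dn : forall eta, 0 < eta -> exists N, forall n, (N <= n)%N -> - t n - - theta <= eta.
  apply: (@sine_step_le (- theta) a (fun n => - t n) (fun n => - r n)) => //.
  - by rewrite normrN.
  - by move=> n; rewrite normrN.
  - move=> n n0; rewrite tS// -projCN; congr projC; rewrite /sine_step.
    have -> : 2 * pi * (- theta - - t n) = - (2 * pi * (theta - t n)) by ring.
    by rewrite sinN; move: (sin _) => y; ring.
  - rewrite (_ : (fun n => _) = (fun n => (-1) * ((n.+1%:R)^-1 * r n))); last first.
      by apply/funext => n; ring.
    exact: (@is_cvg_seriesZ _ (fun n => (n.+1%:R)^-1 * r n) (-1)).
have tcvg : t n @[n --> \oo] --> theta.
  apply/cvgrPdist_le => e e0; have [N1 H1] := up _ e0; have [N2 H2] := dn _ e0.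
  exists (maxn N1 N2) => // n /=; rewrite geq_max => /andP[n1 n2].
  by have := H1 _ n1; have := H2 _ n2; rewrite ler_norml => ? ?; apply/andP; split; lra.
split=> //.
have sc : sine_step theta a t r n @[n --> \oo] --> theta.
  rewrite (_ : sine_step theta a t r = fun n =>
      t n + (- (harmonic n * (`|a| * sin (2 * pi * (t n - theta))))
    + Num.sg a * ((n.+1%:R)^-1 * r n))); last first.
    by apply/funext => n; rewrite sine_stepE addrA.
  rewrite -[X in _ --> X](addr0 theta); apply: cvgD => //.
  rewrite -[X in _ --> X](addr0 0) -[X in X + _]oppr0; apply: cvgD; first apply: cvgN.
    apply/cvgrPdist_le => e e0.
    have e1 : 0 < e / (`|a| + 1) by rewrite divr_gt0// ltr_wpDl.
    have /cvgrPdist_le/(_ _ e1) := @cvg_harmonic R.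
    apply: filterS => n; rewrite !sub0r !normrN => hn.
    rewrite normrM; apply: (@le_trans _ _ (e / (`|a| + 1) * (`|a| + 1))); last first.
      by rewrite mulfVK// gt_eqF// ltr_wpDl.
    apply: ler_pM => //; rewrite normrM normr_id; apply: (@le_trans _ _ (`|a| * 1)).
      by rewrite ler_wpM2l// sin_max.
    by rewrite mulr1 lerDl.
  rewrite -[X in _ --> X](mulr0 (Num.sg a)); apply: cvgMr.
  exact: cvg_series_cvg_0.
have e0 : 0 < 1/4 - `|theta| by rewrite subr_gt0.
have /cvgrPdist_le/(_ _ e0)[N _ HN] := sc.
apply: (@sub_finite_set _ _ `I_N); last exact: finite_II.
move=> n /= [_]; rewrite ltnNge => H; apply/negP => Nn; apply: H.
have := HN n Nn; rewrite /= => hn.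
have := ler_normB theta (theta - sine_step theta a t r n).
by rewrite subKr => /le_trans; apply; lra.
Qed.

End projected_recursion.

(** * Almost sure convergence *)

Section real_lemmas.
Variable R : realType.

(** Both denominators are at least c and truncation is 1-Lipschitz. An error in the density thus
    enters the drift linearly. *)
Lemma inv_max_lip (c x y : R) : 0 < c ->
  `|(Num.max c x)^-1 - (Num.max c y)^-1| <= c^-1 ^+ 2 * `|x - y|.
Proof.
move=> c0.
have lo z : c <= Num.max c z by rewrite le_max lexx.
have pos z : 0 < Num.max c z := lt_le_trans c0 (lo z).
have dist : `|Num.max c y - Num.max c x| <= `|x - y|.
  have h1 := ler_norm (x - y); have h2 := ler_norm (y - x).
  rewrite distrC in h2.
  by case: (leP c x) => ?; case: (leP c y) => ?; rewrite ler_norml; apply/andP; split; lra.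
have -> : (Num.max c x)^-1 - (Num.max c y)^-1 =
    ((Num.max c x)^-1 * (Num.max c y)^-1) * (Num.max c y - Num.max c x).
  have nx := gt_eqF (pos x); have ny := gt_eqF (pos y).
  by field; rewrite nx ny.
rewrite normrM ler_pM// normrM !gtr0_norm ?invr_gt0// expr2.
by rewrite ler_pM// ?invr_ge0 ?(ltW (pos _))// lef_pV2 ?posrE.
Qed.

Lemma cvg_series_eventually (u v : R ^nat) N : (forall n, (N <= n)%N -> u n = v n) ->
  cvgn (series u) -> cvgn (series v).
Proof.
move=> uv uc.
have vE n : (N <= n)%N -> series v n = series u n + (series v N - series u N).
  elim: n => [|n IH]; first by rewrite leqn0 => /eqP ->; ring.
  rewrite leq_eqVlt => /predU1P[<-|]; first by ring.
  rewrite ltnS => Nn.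
  by rewrite !seriesSr IH// uv//; ring.
move: uc => /cvg_ex[l ul].
apply/cvg_ex; exists (l + (series v N - series u N)).
have H : (fun n => series u n + (series v N - series u N)) @ \oo -->
    l + (series v N - series u N) by apply: cvgD => //; exact: cvg_cst.
apply: cvg_trans H; apply: near_eq_cvg.
by apply: filterS (nbhs_infty_ge N) => n Nn; rewrite (vE n).
Qed.

Lemma cvg_series_unshift (u : R ^nat) : cvgn (series (fun n => u n.+1)) -> cvgn (series u).
Proof.
move=> /cvg_ex[l ul]; apply/cvg_ex; exists (u 0%N + l).
rewrite -cvg_shiftS.
rewrite (_ : (fun n => _) = fun n => u 0%N + series (fun n => u n.+1) n).
  by apply: cvgD => //; exact: cvg_cst.
apply/funext => n; rewrite /series/= big_nat_recl//.
Qed.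

End real_lemmas.

Section ae_convergence.
Context d (T : measurableType d) (R : realType) (P : probability T R).
Variables (X eps : nat -> {RV P >-> R}) (Y : nat -> T -> R) (f K g : R -> R).
Variables (theta alpha th1 M Kb G L gmin F S : R).
Hypothesis indep : mutually_independent P (fun bn => sample X eps bn : T -> R).
Hypothesis X_law : forall n (A : set R), measurable A ->
  P (X n @^-1` A) = (\int[lebesgue_measure]_(x in A) (g x)%:E)%E.
Hypothesis eps_mean : forall n, \int[P]_w eps n w = 0.
Hypothesis eps_sqr : forall n, (\int[P]_w (eps n w ^+ 2)%:E <= S%:E)%E.
Hypothesis K0 : forall u, 0 <= K u.
Hypothesis K_even : forall u, K (- u) = K u.
Hypothesis K_cont : continuous K.
Hypothesis M0 : 0 <= M.
Hypothesis K_supp : forall u, M < `|u| -> K u = 0.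
Hypothesis K_bound : forall u, K u <= Kb.
Hypothesis K_int : (\int[lebesgue_measure]_x (K x)%:E = 1)%E.
Hypothesis g0 : forall x, 0 <= g x.
Hypothesis mg : measurable_fun setT g.
Hypothesis g_supp : forall x, 1/2 < `|x| -> g x = 0.
Hypothesis g_bound : forall x, g x <= G.
Hypothesis gmin0 : 0 < gmin.
Hypothesis g_min : forall x, `|x| <= 1/2 -> gmin <= g x.
Hypothesis g_lip : forall x y, `|x| <= 1/2 -> `|y| <= 1/2 -> `|g x - g y| <= L * `|x - y|.
Hypothesis L0 : 0 <= L.
Hypothesis alpha01 : 0 < alpha < 1.
Hypothesis mf : measurable_fun setT f.
Hypothesis f_even : forall x, f (- x) = f x.
Hypothesis f_bound : forall x, `|f x| <= F.
Hypothesis f_per : forall x, f (x + 1) = f x.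
Hypothesis YE : forall n w, Y n w = f (X n w - theta) + eps n w.
Hypothesis theta14 : `|theta| < 1/4.
Hypothesis th1_14 : `|th1| <= 1/4.

Notation mu := (@lebesgue_measure R).
Notation Xf := (fun n => X n : T -> R).
Notation gh := (ghat K alpha Xf).
Let f1 := \int[mu]_(x in `[(- (1/2))%R, (1/2)%R]) (cos (2 * pi * x) * f x).
Hypothesis f1_neq0 : f1 != 0.
Notation th := (theta_hat K alpha f1 th1 Xf Y).
Let c := gmin / 4.

Let c0 : 0 < c. Proof. by rewrite divr_gt0. Qed.
Let c_le : c <= gmin.
Proof. by rewrite /c ler_pdivrMr// ler_peMr ?ltW//; lra. Qed.
Let F0 : 0 <= F. Proof. exact: le_trans (f_bound 0). Qed.
Let G0 : 0 <= G. Proof. exact: le_trans (g_bound 0). Qed.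
Let Kb0 : 0 <= Kb. Proof. exact: le_trans (K_bound 0). Qed.
Let mK : measurable_fun setT K. Proof. exact: continuous_measurable_fun. Qed.

(* Truncating the density estimate below at c makes the increments bounded; almost
   surely it alters only finitely many of them. *)
Let weight n w x : R := sin (2 * pi * (x - th n w)) / Num.max c (gh n w x).
Let signal n w x : R := weight n w x * f (x - theta).
(** Only X_{n+1} is integrated, the estimates at w being frozen: this is the conditional mean of the
    truncated increment given the past. [xi] is the innovation due to X_{n+1}, and [zeta] the one
    due to the noise. *)
Let drift n w : R := \int[P]_w' signal n w (X n.+1 w').
Let xi n w : R := signal n w (X n.+1 w) - drift n w.
Let zeta n w : R := weight n w (X n.+1 w) * eps n.+1 w.

Let Rintegral_const (r : R) : \int[P]__ r = r.
Proof. by rewrite /Rintegral integral_cst1. Qed.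

Let max_gt0 n w x : 0 < Num.max c (gh n w x).
Proof. by rewrite lt_max c0. Qed.

Let weight_le n w x : `|weight n w x| <= c^-1.
Proof.
rewrite normrM -[leRHS]mul1r ler_pM//; first exact: sin_max.
by rewrite gtr0_norm ?invr_gt0// lef_pV2 ?posrE// le_max lexx.
Qed.

Let signal_le n w x : `|signal n w x| <= c^-1 * F.
Proof. by rewrite normrM ler_pM// weight_le. Qed.

Section measurability.
Context dE (E : measurableType dE) (W : E -> T) (n : nat).
Hypothesis mX : forall i, (i <= n)%N -> measurable_fun setT (X i \o W).
Hypothesis me : forall i, (i <= n)%N -> measurable_fun setT (eps i \o W).

Lemma measurable_weight (u : E -> R) : measurable_fun setT u ->
  measurable_fun setT (fun e => weight n (W e) (u e)).
Proof.
move=> mu_; apply: measurable_funM.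
  apply: measurable_sin_shift => //; exact: (@measurable_theta_hat _ _ _ Xf (fun n => eps n : T -> R) Y f K theta alpha f1 th1 mf mK K0 YE).
apply: measurable_inv_ge0; last by move=> e; exact: ltW.
apply: measurable_maxr => //; apply: measurable_ghat => // i /andP[_]; exact: mX.
Qed.

Lemma measurable_signal (u : E -> R) : measurable_fun setT u ->
  measurable_fun setT (fun e => signal n (W e) (u e)).
Proof.
move=> mu_; apply: measurable_funM; first exact: measurable_weight.
by apply: (measurableT_comp mf); exact: measurable_funB.
Qed.
End measurability.

Let int_signal n w : P.-integrable setT (EFin \o (fun w' => signal n w (X n.+1 w'))).
Proof.
apply: (@bounded_integrable _ _ _ _ _ (c^-1 * F)) => //.
by apply: (@measurable_signal _ _ (fun _ : T => w)) => // i _; exact: measurable_cst.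
Qed.

Let drift_le n w : `|drift n w| <= c^-1 * F.
Proof.
apply: le_trans (le_normr_Rintegral measurableT (int_signal n w)) _.
rewrite -lee_fin fineK; last first.
  apply: integrable_fin_num => //.
  by have := int_signal n w => /integrable_norm.
rewrite -(integral_cst1 P); apply: ge0_le_integral => //.
- by apply/measurable_EFinP; apply: measurableT_comp => //; exact/measurable_EFinP/(measurable_int P).
- by move=> w' _; rewrite lee_fin.
Qed.

(** Adding the bound b of the integrand makes it nonnegative, so that measurability of partial
    integrals follows from Tonelli. *)
Lemma measurable_drift dE (E : measurableType dE) (W : E -> T) n :
  (forall i, (i <= n)%N -> measurable_fun setT (X i \o W)) ->
  (forall i, (i <= n)%N -> measurable_fun setT (eps i \o W)) ->
  measurable_fun setT (fun e => drift n (W e)).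
Proof.
move=> mX me; set b := c^-1 * F.
have shift e : drift n (W e) =
    fine (\int[P]_w' (signal n (W e) (X n.+1 w') + b)%:E)%E - b.
  have : \int[P]_w' (signal n (W e) (X n.+1 w') + b) = drift n (W e) + b.
    rewrite RintegralD//; last exact: (@bounded_integrable _ _ _ _ _ `|b|).
    by rewrite Rintegral_const.
  by rewrite /Rintegral => ->; rewrite addrK.
rewrite (_ : (fun e => _) = fun e =>
  fine (\int[P]_w' (signal n (W e) (X n.+1 w') + b)%:E)%E - b); last first.
  by apply/funext => e; exact: shift.
apply: measurable_funB => //.
apply: (measurableT_comp (@fine_measurable R setT measurableT)).
apply: (measurable_fun_fubini_tonelli_F (m2 := P)
  (fun z : E * T => (signal n (W z.1) (X n.+1 z.2) + b)%:E)).
  apply/measurable_EFinP; apply: measurable_funD => //.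
  apply: (@measurable_signal _ _ (fun z : E * T => W z.1)) => [i ni|i ni|].
  - exact: (measurableT_comp (mX i ni)).
  - exact: (measurableT_comp (me i ni)).
  - exact: measurableT_comp.
move=> z; rewrite lee_fin; have := signal_le n (W z.1) (X n.+1 z.2).
by rewrite ler_norml => /andP[? _]; rewrite -lerBlDr sub0r.
Qed.

Section innovations_measurability.
Context dE (E : measurableType dE) (W : E -> T) (n : nat).
Hypothesis mX : forall i, (i <= n.+1)%N -> measurable_fun setT (X i \o W).
Hypothesis me : forall i, (i <= n.+1)%N -> measurable_fun setT (eps i \o W).

Lemma measurable_xi : measurable_fun setT (fun e => xi n (W e)).
Proof.
apply: measurable_funB; last first.
  by apply: measurable_drift => i ni; [apply: mX|apply: me]; exact: leqW.
by apply: measurable_signal => [i ni|i ni|]; [apply: mX|apply: me|apply: mX] => //; exact: leqW.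
Qed.

Lemma measurable_zeta : measurable_fun setT (fun e => zeta n (W e)).
Proof.
apply: measurable_funM; last exact: me.
by apply: measurable_weight => [i ni|i ni|]; [apply: mX|apply: me|apply: mX] => //; exact: leqW.
Qed.
End innovations_measurability.

Let xi_le n w : `|xi n w| <= 2 * (c^-1 * F).
Proof.
apply: le_trans (ler_normB _ _) _; rewrite mulr_natl mulr2n.
by apply: lerD; [exact: signal_le|exact: drift_le].
Qed.

Let mxi n : measurable_fun setT (xi n).
Proof. exact: (@measurable_xi _ _ id). Qed.

Let mzeta n : measurable_fun setT (zeta n).
Proof. exact: (@measurable_zeta _ _ id). Qed.

Let hX k i : (i <= k)%N -> measurable_fun setT (X i : hist X eps k.+1.*2 -> R).
Proof. by move=> ik; apply: hist_X; rewrite ltn_double ltnS. Qed.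

Let he k i : (i <= k)%N -> measurable_fun setT (eps i : hist X eps k.+1.*2 -> R).
Proof. by move=> ik; apply: hist_eps; rewrite doubleS !ltnS leq_double. Qed.

Let hX' k i : (i <= k.+1)%N -> measurable_fun setT (X i : hist X eps k.+1.*2.+1 -> R).
Proof. by move=> ik; apply: hist_X; rewrite ltnS leq_double. Qed.

Let he' k i : (i <= k)%N -> measurable_fun setT (eps i : hist X eps k.+1.*2.+1 -> R).
Proof. by move=> ik; apply: hist_eps; rewrite ltnS ltn_double ltnS. Qed.

(** Before X_{k+1} is drawn, [xi j] is already determined; with the past frozen, [xi k] is a
    centered function of X_{k+1}. *)
Lemma xi_orthogonal j k : (j < k)%N -> \int[P]_w (xi j w * xi k w) = 0.
Proof.
move=> jk.
have prod_le e x : `|xi j e * (signal k e x - drift k e)| <=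
    2 * (c^-1 * F) * (2 * (c^-1 * F)).
  rewrite normrM ler_pM//; apply: le_trans (ler_normB _ _) _.
  by rewrite [leRHS]mulr_natl mulr2n; apply: lerD; [exact: signal_le|exact: drift_le].
have := @freezing_centered _ _ _ P _ _ (hist_id X eps k.+1.*2) (X k.+1)
  (hist_indep_X indep (n := k.+1))
  (fun z => xi j (z.1 : T) * (signal k (z.1 : T) z.2 - drift k (z.1 : T))).
apply.
- apply: measurable_funM.
    apply: (@measurable_xi _ _ (fun z : hist X eps k.+1.*2 * R => z.1 : T)) => i ij.
      exact: (measurableT_comp (hX (leq_trans ij jk)) measurable_fst).
    exact: (measurableT_comp (he (leq_trans ij jk)) measurable_fst).
  apply: measurable_funB.
    apply: (@measurable_signal _ _ (fun z : hist X eps k.+1.*2 * R => z.1 : T)) => // i ik.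
      exact: (measurableT_comp (hX ik) measurable_fst).
    exact: (measurableT_comp (he ik) measurable_fst).
  apply: (@measurable_drift _ _ (fun z : hist X eps k.+1.*2 * R => z.1 : T)) => // i ik.
    exact: (measurableT_comp (hX ik) measurable_fst).
  exact: (measurableT_comp (he ik) measurable_fst).
- apply: bounded_integrable; last by move=> w; exact: prod_le.
  by apply: measurable_funM; [exact: mxi|exact: mxi].
- move=> e; apply: bounded_integrable; last by move=> w; exact: prod_le.
  rewrite /=; apply: measurable_funM; first exact: measurable_cst.
  apply: measurable_funB; last exact: measurable_cst.
  by apply: (@measurable_signal _ _ (fun _ : T => e)) => // i _; exact: measurable_cst.
- move=> e /=; have iB : P.-integrable setT (EFin \o (fun _ : T => drift k e)).
    exact: (@bounded_integrable _ _ _ _ _ `|drift k e|).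
  rewrite RintegralZl//; last first.
    by rewrite (_ : _ \o _ = fun w => ((EFin \o (fun w' => signal k e (X k.+1 w'))) w - (EFin \o (fun=> drift k e)) w)%E)//; exact: integrableB.
  rewrite RintegralB// Rintegral_const.
  by rewrite subrr mulr0.
Qed.

Lemma zeta_sqr n : (\int[P]_w (zeta n w ^+ 2)%:E <= (c^-1 ^+ 2 * S)%:E)%E.
Proof.
apply: (@le_trans _ _ (\int[P]_w ((c^-1 ^+ 2)%:E * (eps n.+1 w ^+ 2)%:E))%E).
  apply: ge0_le_integral => //.
  - by move=> w _; rewrite lee_fin sqr_ge0.
  - by apply/measurable_EFinP; exact: measurable_funX.
  - by apply/measurable_EFinP; apply: measurable_funM => //; exact: measurable_funX.
  move=> w _; rewrite -EFinM lee_fin exprMn ler_wpM2r ?sqr_ge0//.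
  by rewrite -real_normK ?num_real// lerXn2r ?nnegrE// invr_ge0 ltW.
rewrite ge0_integralZl//.
- by rewrite [leRHS]EFinM lee_wpmul2l// lee_fin sqr_ge0.
- by apply/measurable_EFinP; exact: measurable_funX.
- by move=> w _; rewrite lee_fin sqr_ge0.
- by rewrite lee_fin sqr_ge0.
Qed.

Let eps_int n : P.-integrable setT (EFin \o eps n).
Proof.
have := @integrable_mul_of_sqr _ _ _ P (cst 1) (eps n).
rewrite (_ : EFin \o (_ \* _) = EFin \o eps n); last by apply/funext => w /=; rewrite mul1r.
apply=> //; last by apply: le_lt_trans (eps_sqr n) (ltry _).
by under eq_integral do rewrite expr1n; rewrite integral_cst1 ltry.
Qed.

(** The past frozen here contains X_{k+1}, so the weight of eps_{k+1} is a constant. The noise is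
    unbounded, and integrability of the product comes from the second moments. *)
Lemma zeta_orthogonal j k : (j < k)%N -> \int[P]_w (zeta j w * zeta k w) = 0.
Proof.
move=> jk.
have := @freezing_centered _ _ _ P _ _ (hist_id X eps k.+1.*2.+1) (eps k.+1)
  (hist_indep_eps indep (n := k.+1))
  (fun z => zeta j (z.1 : T) * (weight k (z.1 : T) (X k.+1 (z.1 : T)) * z.2)).
apply.
- apply: measurable_funM.
    apply: (@measurable_zeta _ _ (fun z : hist X eps k.+1.*2.+1 * R => z.1 : T)) => i ij.
      exact: (measurableT_comp (hX' (leqW (leq_trans ij jk))) measurable_fst).
    exact: (measurableT_comp (he' (leq_trans ij jk)) measurable_fst).
  apply: measurable_funM => //.
  apply: (@measurable_weight _ _ (fun z : hist X eps k.+1.*2.+1 * R => z.1 : T)) => [i ik|i ik|].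
  - exact: (measurableT_comp (hX' (leqW ik)) measurable_fst).
  - exact: (measurableT_comp (he' ik) measurable_fst).
  - exact: (measurableT_comp (hX' (leqnn _)) measurable_fst).
- apply: integrable_mul_of_sqr; [exact: mzeta|exact: mzeta| |].
    exact: le_lt_trans (zeta_sqr j) (ltry _).
  exact: le_lt_trans (zeta_sqr k) (ltry _).
- move=> e /=.
  rewrite (_ : (fun w => _) = fun w => ((zeta j e * weight k e (X k.+1 e))%:E * (EFin \o eps k.+1) w)%E); last first.
    by apply/funext => w; rewrite /= -EFinM mulrA.
  exact: integrableZl.
- move=> e /=; under eq_Rintegral do rewrite mulrA.
  by rewrite RintegralZl// eps_mean mulr0.
Qed.

Lemma xi_series_cvg : {ae P, forall w, cvgn (series (fun n => (n.+1%:R)^-1 * xi n w))}.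
Proof.
apply: (@orthogonal_series_cvg _ _ _ P xi ((2 * (c^-1 * F)) ^+ 2)) => //.
  move=> n; rewrite -(integral_cst1 P); apply: ge0_le_integral => //.
  - by move=> w _; rewrite lee_fin sqr_ge0.
  - by apply/measurable_EFinP; exact: measurable_funX.
  - move=> w _; rewrite lee_fin -real_normK ?num_real// lerXn2r ?nnegrE//.
    exact: le_trans (xi_le n w).
exact: xi_orthogonal.
Qed.

Lemma zeta_series_cvg : {ae P, forall w, cvgn (series (fun n => (n.+1%:R)^-1 * zeta n w))}.
Proof.
apply: (@orthogonal_series_cvg _ _ _ P zeta (c^-1 ^+ 2 * S)) => //.
- exact: zeta_sqr.
- exact: zeta_orthogonal.
Qed.

Let dens_err n w : R := \int[P]_w' `|gh n w (X n.+1 w') - g (X n.+1 w')|.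

Let int_err n w : P.-integrable setT
  (EFin \o (fun w' => `|gh n w (X n.+1 w') - g (X n.+1 w')|)).
Proof.
pose gb := n%:R^-1 * \sum_(1 <= i < n.+1) ((bandwidth alpha i)^-1 * Kb).
apply: (@bounded_integrable _ _ _ _ _ (gb + G)).
  apply: measurableT_comp => //; apply: measurable_funB; last exact: (measurableT_comp mg).
  by apply: (@measurable_ghat _ _ _ Xf _ _ mK _ _ (fun _ : T => w)) => // i _; exact: measurable_cst.
move=> w'; rewrite normr_id; apply: le_trans (ler_normB _ _) _; apply: lerD.
  rewrite ger0_norm ?ghat_ge0// ler_wpM2l ?invr_ge0// ler_sum// => i _.
  by rewrite ler_wpM2l// invr_ge0 bandwidth_ge0.
by rewrite ger0_norm.
Qed.

Let dens_errE n w :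
  (dens_err n w)%:E = (\int[P]_w' `|gh n w (X n.+1 w') - g (X n.+1 w')|%:E)%E.
Proof. 
rewrite /dens_err /Rintegral fineK//.
exact: (integrable_fin_num measurableT (int_err n w)). Qed.

(** With the true density in place of the estimate, the mean of the increment is exactly the sine
    drift; the error of the replacement is controlled by the Lipschitz bound for truncated
    inverses. *)
Lemma drift_bias n w :
  `|drift n w - f1 * sin (2 * pi * (theta - th n w))| <= c^-1 ^+ 2 * F * dens_err n w.
Proof.
(* Since c <= gmin, truncation does not alter g on its support, and the factor g of the law of
   X_{n+1} cancels there. *)
pose q x := sin (2 * pi * (x - th n w)) / Num.max c (g x) * f (x - theta).
have mq : measurable_fun setT q.
  apply: measurable_funM; last by apply: (measurableT_comp mf); exact: measurable_funB.
  apply: measurable_funM; first exact: measurable_sin_shift.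
  apply: measurable_inv_ge0; first exact: measurable_maxr.
  by move=> x; rewrite le_max ltW.
have qb x : `|q x| <= c^-1 * F.
  rewrite normrM ler_pM// normrM -[leRHS]mul1r ler_pM//; first exact: sin_max.
  rewrite ger0_norm ?invr_ge0 ?le_max ?(ltW c0)//.
  by rewrite lef_pV2 ?posrE// ?lt_max ?c0// le_max lexx.
have iq : P.-integrable setT (EFin \o (fun w' => q (X n.+1 w'))).
  by apply: (@bounded_integrable _ _ _ _ _ (c^-1 * F)) => //; exact: (measurableT_comp mq).
have -> : f1 * sin (2 * pi * (theta - th n w)) = \int[P]_w' q (X n.+1 w').
  rewrite -(sin_moment mf f_even f_bound f_per (theta := theta) (th n w)); last first.
    by apply: lt_trans theta14 _; lra.
  rewrite /Rintegral (integral_X X_law mg g0 n.+1 mq) integral_mkcond.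
  congr fine; apply: eq_integral => x _; rewrite patchE; case: ifPn.
    rewrite mem_setE in_itv/= => xJ.
    have gx : gmin <= g x by apply: g_min; rewrite ler_norml.
    have gx0 : 0 < g x by exact: lt_le_trans gmin0 gx.
    rewrite /q max_r; last exact: le_trans c_le gx.
    by congr EFin; field; rewrite gt_eqF.
  rewrite mem_setE in_itv/= => xJ; rewrite g_supp ?mulr0//.
  by rewrite ltNge ler_norml.
rewrite -RintegralB//.
apply: le_trans (le_normr_Rintegral measurableT _) _.
  exact: (integrableB measurableT (int_signal n w) iq).
rewrite -RintegralZl//; apply: le_Rintegral => //.
- exact: (integrable_norm (integrableB measurableT (int_signal n w) iq)).
- exact: (integrableZl measurableT _ (int_err n w)).
move=> w' _ /=; rewrite /signal /weight /q; set x := X n.+1 w'.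
rewrite [X in `|X|](_ : _ = sin (2 * pi * (x - th n w)) *
  ((Num.max c (gh n w x))^-1 - (Num.max c (g x))^-1) * f (x - theta)); last by ring.
rewrite normrM [leRHS]mulrAC ler_pM// normrM -[leRHS]mul1r ler_pM//; first exact: sin_max.
exact: inv_max_lip.
Qed.

Let mdens_err n : measurable_fun setT (dens_err n).
Proof.
apply: (measurableT_comp (@fine_measurable R setT measurableT)).
apply: (measurable_fun_fubini_tonelli_F (m2 := P)
  (fun z : T * T => (`|gh n z.1 (X n.+1 z.2) - g (X n.+1 z.2)|)%:E)).
  have mX2 : measurable_fun setT (fun z : T * T => X n.+1 z.2) by exact: measurableT_comp.
  apply/measurable_EFinP; apply: measurableT_comp => //; apply: measurable_funB.
    apply: (@measurable_ghat _ _ _ Xf _ _ mK _ _ (fun z : T * T => z.1)) => // i _.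
    exact: (measurableT_comp (measurable_funP (X i)) measurable_fst).
  exact: (measurableT_comp mg).
by move=> z; rewrite lee_fin.
Qed.

Lemma dens_err_series_cvg :
  {ae P, forall w, cvgn (series (fun n => (n.+1%:R)^-1 * dens_err n w))}.
Proof.
have [a0 a1] := andP alpha01.
pose beta := (1 - alpha) / 2.
have b0 : 0 < beta by rewrite divr_gt0// subr_gt0.
have [C1 [C2 H]] : exists C1 C2 : R, forall n, (0 < n)%N ->
    (\int[P]_w (dens_err n w)%:E <= (C1 * n%:R `^ (- beta) + C2 * n%:R `^ (- alpha))%:E)%E.
  do 2 eexists; move=> n n0; under eq_integral do rewrite dens_errE.
  exact: (ghat_mean_error indep X_law K0 K_cont M0 K_supp K_bound K_int g0 mg
    g_supp g_bound g_lip L0 alpha01 n0).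
have powS n (a : R) : n.+1%:R^-1 * n.+1%:R `^ (- a) = n.+1%:R `^ (- (1 + a)) :> R.
  by rewrite opprD powRD ?pnatr_eq0 ?implybT// powR_inv1// ler0n.
(* The mean-error bound holds for n > 0 only, so the series starts at index 1 and its first term is
   restored at the end. The signs of C1 and C2 are unknown here, hence their absolute values. *)
have := @ae_series_cvg _ _ _ P (fun n w => (n.+2%:R)^-1 * dens_err n.+1 w)
  (fun n => `|C1| * n.+1%:R `^ (- (1 + beta)) + `|C2| * n.+1%:R `^ (- (1 + alpha))).
move=> /(_ _ _ _ _)/wrap[].
- by move=> n; exact: measurable_funM.
- by move=> n w; rewrite mulr_ge0// ?invr_ge0//; apply: Rintegral_ge0.
- move=> n; under eq_integral do rewrite EFinM.
  rewrite ge0_integralZl//; last 2 first.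
  - exact/measurable_EFinP.
  - by move=> w _; rewrite lee_fin; apply: Rintegral_ge0.
  apply: (@le_trans _ _ ((n.+1%:R)^-1%:E *
    (`|C1| * n.+1%:R `^ (- beta) + `|C2| * n.+1%:R `^ (- alpha))%:E)%E).
    apply: lee_pmul.
    - by rewrite lee_fin invr_ge0.
    - by apply: integral_ge0 => w _; rewrite lee_fin; apply: Rintegral_ge0.
    - by rewrite lee_fin lef_pV2 ?posrE// ler_nat.
    - apply: le_trans (H n.+1 isT) _; rewrite lee_fin.
      by rewrite lerD// ler_wpM2r ?powR_ge0// ler_norm.
  rewrite -EFinM lee_fin mulrDr ![(n.+1%:R)^-1 * (_ * _)]mulrCA.
  by rewrite !powS.
- apply: is_cvg_seriesD.
    by apply: (@is_cvg_seriesZ _ (fun n => n.+1%:R `^ (- (1 + beta))) `|C1|); exact: pseries_cvg.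
  by apply: (@is_cvg_seriesZ _ (fun n => n.+1%:R `^ (- (1 + alpha))) `|C2|); exact: pseries_cvg.
apply: filterS => w Hw.
exact: (@cvg_series_unshift R (fun n => (n.+1%:R)^-1 * dens_err n w)).
Qed.

(** The indicators of the bad events have summable means, so their series converges almost surely;
    its terms are eventually below 1, hence 0. *)
Lemma ghat_eventually_ge :
  {ae P, forall w, exists N, forall n, (N <= n)%N -> c <= gh n w (X n.+1 w)}.
Proof.
have [C [c' [c'0 H]]] := ghat_lower_tail indep X_law K0 K_even K_cont M0 K_supp K_bound
  K_int g0 mg g_supp g_bound gmin0 g_min alpha01.
have [a0 a1] := andP alpha01.
have := @ae_series_cvg _ _ _ P (fun n w => ((gh n.+1 w (X n.+2 w) < c)%R)%:R)
  (fun n => C * expR (- (c' * n.+1%:R `^ (1 - alpha)))).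
move=> /(_ _ _ _ _)/wrap[].
- move=> n; set B := [set w | gh n.+1 w (X n.+2 w) < c].
  rewrite (_ : (fun w => _) = \1_B); last first.
    by apply/funext => w; rewrite indicE /B mem_setE.
  apply: measurable_indic; rewrite (_ : B = setT `&` (fun w => gh n.+1 w (X n.+2 w)) @^-1` `]-oo, c[%classic).
    apply: (@measurable_ghat _ _ _ Xf _ _ mK _ _ id) => //.
  by rewrite setTI; apply/seteqP; split => w /=; rewrite in_itv.
- by move=> n w; rewrite ler0n.
- by move=> n; exact: (H n.+1 isT).
- apply: (@is_cvg_seriesZ _ (fun n => expR (- (c' * n.+1%:R `^ (1 - alpha)))) C).
  by apply: expR_powR_summable => //; rewrite subr_gt0.
apply: filterS => w /cvg_series_cvg_0 /cvgrPdist_lt /(_ 1 ltr01)[N _ HN].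
exists N.+1 => -[//|n] Nn.
have := HN n Nn; rewrite /= sub0r normrN leNgt.
by case: (_ < c) => //; rewrite normr1 ltxx.
Qed.

Lemma theta_hat_le n w : `|th n w| <= 1/4.
Proof. by case: n => [|[|n]] //; exact: projC_bound. Qed.

Lemma theta_hat_cvg : {ae P, forall w,
  th n w @[n --> \oo] --> theta /\
  finite_set [set n : nat | (0 < n)%N /\
    ~ (`|pre_step K alpha f1 Xf Y n (th n w) w| <= 1/4)]}.
Proof.
apply: filterS3 (xi_series_cvg) (zeta_series_cvg)
  (filterI dens_err_series_cvg ghat_eventually_ge) => w xc zc [ec [N HN]].
(* The remainder is taken for the original, untruncated increment, so that the recursion is exact
   from the first step. *)
pose r n := That K alpha Xf Y n (th n w) w - f1 * sin (2 * pi * (theta - th n w)).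
have stepE n : pre_step K alpha f1 Xf Y n (th n w) w = sine_step theta f1 (th ^~ w) r n.
  by rewrite /pre_step /sine_step /r [f1 * _ + _]addrC subrK.
rewrite (_ : [set n | _] = [set n | (0 < n)%N /\
  ~ (`|sine_step theta f1 (th ^~ w) r n| <= 1/4)]); last first.
  by apply/seteqP; split => n /=; rewrite stepE.
apply: sine_step_cvg => //.
- by move=> n; exact: theta_hat_le.
- by case=> // n _; rewrite -stepE.
pose bias n := drift n w - f1 * sin (2 * pi * (theta - th n w)).
(* From N on the truncation is inactive and r = xi + zeta + bias; finitely many terms do not affect
   convergence. *)
apply: (@cvg_series_eventually _ (fun n => (n.+1%:R)^-1 * xi n w +
  (n.+1%:R)^-1 * zeta n w + (n.+1%:R)^-1 * bias n) _ N).
  move=> n Nn; rewrite -!mulrDr; congr (_ * _).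
  rewrite /r /That YE /bias /xi /zeta /signal /weight max_r ?HN//.
  by ring.
apply: is_cvg_seriesD; first exact: is_cvg_seriesD.
apply: normed_cvg.
apply: (@series_le_cvg _ _ (fun n => (c^-1 ^+ 2 * F) * ((n.+1%:R)^-1 * dens_err n w))).
- by move=> n; exact: normr_ge0.
- move=> n; rewrite !mulr_ge0 ?invr_ge0 ?(ltW c0)//.
  by apply: Rintegral_ge0.
- move=> n; rewrite /= normrM ger0_norm ?invr_ge0// [leRHS]mulrCA ler_wpM2l ?invr_ge0//.
  exact: drift_bias.
- exact: (@is_cvg_seriesZ _ (fun n => (n.+1%:R)^-1 * dens_err n w)).
Qed.

End ae_convergence.

(** * Equality in law, and regularity of the kernel and of the density *)

Section same_law.
Context d (T : measurableType d) (R : realType) (P : probability T R).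
Variables (Z Z' : {RV P >-> R}).
Hypothesis ZZ' : forall A : set R, measurable A -> P (Z @^-1` A) = P (Z' @^-1` A).

(** Carries the moment assumptions, stated for eps_0, over to every eps_n. *)
Lemma ge0_integral_same_law (phi : R -> \bar R) : measurable_fun setT phi ->
  (forall x, 0 <= phi x)%E -> (\int[P]_w phi (Z w) = \int[P]_w phi (Z' w))%E.
Proof.
move=> mphi phi0.
transitivity (\int[distribution P Z]_x phi x)%E.
  by rewrite ge0_integral_distribution.
transitivity (\int[distribution P Z']_x phi x)%E; last first.
  by rewrite ge0_integral_distribution.
by apply: eq_measure_integral => A mA _; exact: ZZ'.
Qed.

Lemma integral_same_law : (\int[P]_w (Z w)%:E = \int[P]_w (Z' w)%:E)%E.
Proof.
have posE (U : T -> R) : ((fun w => (U w)%:E)^\+ = fun w => (@EFin R)^\+ (U w))%E.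
  by apply/funext => w; rewrite !unlock.
have negE (U : T -> R) : ((fun w => (U w)%:E)^\- = fun w => (@EFin R)^\- (U w))%E.
  by apply/funext => w; rewrite !unlock.
rewrite integralE [RHS]integralE !posE !negE.
congr (_ - _)%E.
- by apply: ge0_integral_same_law => //; exact: measurable_funepos.
- by apply: ge0_integral_same_law => //; exact: measurable_funeneg.
Qed.

End same_law.

Section regularity.
Variable R : realType.

Lemma lipschitz_continuous_real (u : R -> R) (L : R) :
  (forall x y, `|u x - u y| <= L * `|x - y|) -> continuous u.
Proof.
move=> uL x; apply/cvgrPdist_le => e e0.
have : \forall y \near x, `|x - y| <= e / (`|L| + 1).
  exists (e / (`|L| + 1)); first by rewrite /= divr_gt0.
  by move=> y /= /ltW.
apply: filterS => y xy; apply: le_trans (uL x y) _.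
apply: (@le_trans _ _ ((`|L| + 1) * `|x - y|)).
  by rewrite ler_wpM2r// (le_trans (ler_norm L))// lerDl.
by rewrite mulrC -ler_pdivlMr.
Qed.

Lemma lipschitz_compact_bound (u : R -> R) (L M : R) :
  (forall x y, `|u x - u y| <= L * `|x - y|) -> (forall x, M < `|x| -> u x = 0) ->
  (forall x, 0 <= u x) -> forall x, u x <= u 0 + `|L| * `|M|.
Proof.
move=> uL uM u0 x; have [xM|/uM ->] := leP `|x| M; last first.
  by rewrite addr_ge0// mulr_ge0.
have := uL x 0; rewrite subr0 ler_norml => /andP[_ h].
rewrite -lerBlDl; apply: le_trans h _.
apply: (@le_trans _ _ (`|L| * `|x|)); first by rewrite ler_wpM2r// ler_norm.
by rewrite ler_wpM2l// (le_trans xM)// ler_norm.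
Qed.

(** The mean value theorem needs the derivative in the open interval only, so the bound extends to
    the endpoints, where the density has its jumps. *)
Lemma derive1_bounded_lipschitz (u : R -> R) (a b M : R) :
  {within `[a, b], continuous u} ->
  (forall x, a < x < b -> derivable u x 1) ->
  (forall x, a < x < b -> `|derive1 u x| <= M) ->
  forall x y, a <= x <= b -> a <= y <= b -> `|u x - u y| <= `|M| * `|x - y|.
Proof.
move=> uc ud uM.
suff core x y : a <= x -> x < y -> y <= b -> `|u x - u y| <= `|M| * `|x - y|.
  move=> x y /andP[ax xb] /andP[ay yb]; have [xy|yx|->] := ltgtP x y.
  - exact: core.
  - by rewrite distrC [X in _ * X]distrC; exact: core.
  - by rewrite !subrr !normr0 mulr0.
move=> ax xy yb.
have [||t] := @MVT R u (derive1 u) x y xy.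
- move=> t; rewrite in_itv/= => /andP[xt ty].
  have dt : derivable u t 1.
    by apply: ud; rewrite (le_lt_trans ax xt) (lt_le_trans ty yb).
  by apply: DeriveDef => //; rewrite derive1E.
- apply: continuous_subspaceW uc => t /=; rewrite !in_itv/= => /andP[xt ty].
  by rewrite (le_trans ax xt) (le_trans ty yb).
rewrite in_itv/= => /andP[xt ty] E.
rewrite distrC E [X in _ <= _ * X]distrC normrM ler_wpM2r//.
apply: le_trans (ler_norm M); apply: uM.
by rewrite (le_lt_trans ax xt) (lt_le_trans ty yb).
Qed.

Lemma measurable_within_support (u : R -> R) (a b : R) :
  {within `[a, b], continuous u} -> (forall x, ~~ (a <= x <= b) -> u x = 0) ->
  measurable_fun setT u.
Proof.
move=> uc u0; rewrite (_ : u = u \_ `[a, b]%classic).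
  apply/(measurable_restrictT _ (measurable_itv _)).
  exact: subspace_continuous_measurable_fun.
apply/funext => x; rewrite patchE; case: ifPn => //.
by rewrite mem_setE in_itv/= => /u0.
Qed.

End regularity.

Theorem theorem2p1 (R : realType) (d : measure_display) (T : measurableType d)
  (P : probability T R)
  (X eps Y : nat -> {RV P >-> R}) (f g K : R -> R) (theta alpha th1 : R) :
  (* independence: (X_n) and (eps_n) are independent sequences of independent
     r.v.'s, i.e. the joint family is mutually independent *)
  mutually_independent P (fun bn : bool * nat =>
     if bn.1 then (X bn.2 : T -> R) else (eps bn.2 : T -> R)) ->
  (* each X_n has density g (in particular the X_n are identically distributed) *)
  (forall n (A : set R), measurable A ->
     P (X n @^-1` A) = (\int[lebesgue_measure]_(x in A) (g x)%:E)%E) ->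
  (* the eps_n are identically distributed *)
  (forall n (A : set R), measurable A ->
     P (eps n @^-1` A) = P (eps 0 @^-1` A)) ->
  (* eps has zero mean and finite positive variance *)
  (eps 0 : T -> R) \in Lfun P 2%:E ->
  ('E_P[eps 0%N] = 0)%E ->
  (0 < 'V_P[eps 0%N])%E ->
  (* (i) g : support [-1/2,1/2], positive on it, continuous, twice
     differentiable with bounded derivatives *)
  (forall x, 1/2 < `|x| -> g x = 0) ->
  (forall x, `|x| <= 1/2 -> 0 < g x) ->
  {within `[-(1/2), 1/2], continuous g} ->
  (forall x, `|x| < 1/2 -> derivable g x 1 /\ derivable (derive1 g) x 1) ->
  (exists M : R, forall x, `|x| < 1/2 ->
     `|derive1 g x| <= M /\ `|derive1 (derive1 g) x| <= M) ->
  (* (ii) f even, bounded, 1-periodic (and measurable) *)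
  measurable_fun setT f ->
  (forall x, f (- x) = f x) ->
  (exists M : R, forall x, `|f x| <= M) ->
  (forall x, f (x + 1) = f x) ->
  (* the model *)
  (forall n w, Y n w = f (X n w - theta) + eps n w) ->
  (* f_1 <> 0 *)
  let f1 := Rintegral lebesgue_measure `[-(1/2), 1/2]
              (fun x => cos (2 * pi * x) * f x) in
  f1 != 0 ->
  (* the kernel K *)
  (forall x, K (- x) = K x) ->
  (forall x, 0 <= K x) ->
  (exists L : R, forall x y, `|K x - K y| <= L * `|x - y|) ->
  (exists M : R, forall x, M < `|x| -> K x = 0) ->
  measurable_fun setT K ->
  (\int[lebesgue_measure]_x (K x)%:E = 1)%E ->
  (\int[lebesgue_measure]_x ((K x) ^+ 2)%:E < +oo)%E ->
  (\int[lebesgue_measure]_x (x ^+ 2 * K x)%:E < +oo)%E ->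
  0 < alpha < 1 ->
  `|th1| <= 1/4 ->
  `|theta| < 1/4 ->
  {ae P, forall w, theta_hat K alpha f1 th1 (fun n => X n : T -> R)
                     (fun n => Y n : T -> R) n w @[n --> \oo] --> theta} /\
  {ae P, forall w, finite_set [set n : nat | (0 < n)%N /\
     ~ (`|pre_step K alpha f1 (fun n => X n : T -> R) (fun n => Y n : T -> R) n
          (theta_hat K alpha f1 th1 (fun n => X n : T -> R)
             (fun n => Y n : T -> R) n w) w| <= 1/4)]}.
Proof.
move=> indep X_law eps_law eps_L2 eps_mean _ g_supp g_pos g_cont g_diff [Mg g_der]
  mf f_even [F f_bound] f_per YE f1 f1_neq0 K_even K0 [L K_lip] [M K_supp] _ K_int _ _
  alpha01 th1_14 theta14.
have g0 x : 0 <= g x by have [/g_supp ->|/g_pos/ltW] := ltP (1/2) `|x|.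
have absE (x : R) : (`|x| <= 1/2) = (- (1/2) <= x <= 1/2) by rewrite ler_norml.
have half : - (1/2) <= 1/2 :> R by lra.
(* The extreme values over the compact support provide [G] and [gmin]; the latter is positive
   because g is positive up to and including the endpoints. *)
have [xM xMI g_max] := EVT_max half g_cont.
have [xm xmI g_min] := EVT_min half g_cont.
have main : {ae P, forall w,
  theta_hat K alpha f1 th1 (fun n => X n : T -> R) (fun n => Y n : T -> R) n w
    @[n --> \oo] --> theta /\
  finite_set [set n : nat | (0 < n)%N /\
     ~ (`|pre_step K alpha f1 (fun n => X n : T -> R) (fun n => Y n : T -> R) n
          (theta_hat K alpha f1 th1 (fun n => X n : T -> R)
             (fun n => Y n : T -> R) n w) w| <= 1/4)]}.
  apply: (@theta_hat_cvg _ _ _ _ X eps _ f K g theta alpha th1 `|M| (K 0 + `|L| * `|M|)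
    (g xM) `|Mg| (g xm) F (fine (\int[P]_w (eps 0 w ^+ 2)%:E)%E)) => //.
  - rewrite (_ : (fun bn => _) = fun bn : bool * nat =>
      if bn.1 then (X bn.2 : T -> R) else (eps bn.2 : T -> R))//.
    by apply/funext => -[[] n].
  - move=> n; rewrite /Rintegral (integral_same_law (Z' := eps 0))//.
      by move: eps_mean; rewrite unlock => ->.
    by move=> A mA; exact: eps_law.
  - move=> n; rewrite (@ge0_integral_same_law _ _ _ P (eps n) (eps 0) _ (fun x => (x ^+ 2)%:E))//.
    + by rewrite fineK//; apply: (integrable_fin_num measurableT); exact: Lfun2_integrable_sqr.
    + by move=> A mA; exact: eps_law.
    + by apply/measurable_EFinP; exact: measurable_funX.
    + by move=> x; rewrite lee_fin sqr_ge0.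
  - exact: lipschitz_continuous_real K_lip.
  - by move=> u Mu; apply: K_supp; apply: le_lt_trans Mu; exact: ler_norm.
  - exact: lipschitz_compact_bound.
  - apply: (measurable_within_support g_cont) => x; rewrite -absE -ltNge.
    exact: g_supp.
  - move=> x; have [/g_supp ->|] := ltP (1/2) `|x|; first exact: g0.
    by rewrite absE => xI; apply: g_max; rewrite in_itv.
  - by apply: g_pos; move: xmI; rewrite in_itv/= absE.
  - by move=> x; rewrite absE => xI; apply: g_min; rewrite in_itv.
  - move=> x y; rewrite !absE; apply: (derive1_bounded_lipschitz g_cont) => z zI.
      by apply: (g_diff z _).1; rewrite ltr_norml.
    by apply: (g_der z _).1; rewrite ltr_norml.
by split; apply: filterS main => w [].
Qed.
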